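(* Suppose that $(X,T)$ is a dynamical system with the shadowing property and positive topological entropy. Then $$\mathcal{R}=\{\Phi\in C^0(X,\mathbb{R}): I_\Phi(T)\text{ is not empty and carries full topological entropy}\}$$ is a dense $G_\delta$ subset of $C^0(X,\mathbb{R})$. In fact, for any $\varepsilon>0$, the set $$\mathcal{R}_\varepsilon=\{\Phi\in C^0(X,\mathbb{R}): I_\Phi(T)\text{ is not empty and } h_{\mathrm{top}}(T,I_\Phi(T))>h_{\mathrm{top}}(T)-\varepsilon\}$$ is an open and dense subset of $C^0(X,\mathbb{R})$.
   Context: A dynamical system $(X,T)$ is a compact metric space $(X,d)$ together with a continuous map $T:X\to X$. $C^0(X,\mathbb{R})$ is the space of continuous functions $X\to\mathbb{R}$ with the supremum metric. For $\delta>0$, a sequence $\{x_n\}_{n\ge 0}\subseteq X$ is a $\delta$-pseudo-orbit if $d(Tx_n,x_{n+1})<\delta$ for all $n\geq 0$. $(X,T)$ has the shadowing property if for every $\varepsilon>0$ there is $\delta>0$ such that for every $\delta$-pseudo-orbit $\{x_n\}_{n\ge 0}$ there is $y\in X$ with $d(T^ny,x_n)<\varepsilon$ for all $n\geq 0$. The $\Phi$-irregular set $I_\Phi(T)$ is the set of $x\in X$ for which $\lim_{n\to\infty}\frac1n\sum_{i=0}^{n-1}\Phi(T^ix)$ does not exist. $h_{\mathrm{top}}(T,E)$ is the Bowen topological entropy of a (not necessarily compact or invariant) set $E\subseteq X$: let $B_n(x,\varepsilon)=\{y\in X:\max_{0\le j\le n-1}d(T^jx,T^jy)<\varepsilon\}$;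 let $\mathcal{G}_n(E,\varepsilon)$ be the collection of all finite or countable coverings of $E$ by balls $B_v(x,\varepsilon)$ with $v\geq n$; put $C(E;t,n,\varepsilon,T)=\inf_{C\in\mathcal{G}_n(E,\varepsilon)}\sum_{B_v(x,\varepsilon)\in C}e^{-tv}$, $C(E;t,\varepsilon,T)=\lim_{n\to\infty}C(E;t,n,\varepsilon,T)$, $h_{\mathrm{top}}(E,\varepsilon,T)=\inf\{t:C(E;t,\varepsilon,T)=0\}$ and $h_{\mathrm{top}}(T,E)=\lim_{\varepsilon\to0}h_{\mathrm{top}}(E,\varepsilon,T)$. Write $h_{\mathrm{top}}(T)=h_{\mathrm{top}}(T,X)$ (the usual topological entropy). A set $E\subseteq X$ carries full topological entropy if $h_{\mathrm{top}}(T,E)=h_{\mathrm{top}}(T)$.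
   Formalization: If h_top(T)=+∞ (e.g. the full shift on [0,1]^ℕ), the set R_ε as literally written is empty, so not dense; in that case only, h_top(T)−ε is read as 1/ε. For finite entropy, and for the claim on R, the statement is as written. *)

(* Defs.v *)
From HB Require Import structures.
From mathcomp Require Import all_boot all_order all_algebra.
From mathcomp Require Import all_classical all_reals all_analysis.

Set Implicit Arguments.
Unset Strict Implicit.
Unset Printing Implicit Defensive.

Import Order.TTheory GRing.Theory Num.Theory.
Import numFieldNormedType.Exports.

Local Open Scope classical_set_scope.
Local Open Scope ring_scope.

(* For compact X, the uniformity of this space is that of the supremum metric:
   see nbhs_C0_sup. *)
Definition C0 (R : realType) (X : metricType R) : pseudoMetricType R :=
  initial_topology
    (fun f : continuousType X R => (f : arrow_uniform_type X R)).

Definition C0_fun (R : realType) (X : metricType R) (f : C0 X) : X -> R :=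
  (f : continuousType X R).

Definition pseudo_orbit (R : realType) (X : metricType R) (T : X -> X)
    (delta : R) (x : nat -> X) : Prop :=
  forall n, mdist (T (x n)) (x n.+1) < delta.

Definition shadowing (R : realType) (X : metricType R) (T : X -> X) : Prop :=
  forall eps : R, 0 < eps -> exists2 delta : R, 0 < delta &
    forall x : nat -> X, pseudo_orbit T delta x ->
      exists y, forall n, mdist (iter n T y) (x n) < eps.

Definition birkhoff_average (R : realType) (X : Type) (T : X -> X)
    (Phi : X -> R) (x : X) (n : nat) : R :=
  n%:R^-1 * \sum_(0 <= i < n) Phi (iter i T x).

Definition irregular_set (R : realType) (X : Type) (T : X -> X)
    (Phi : X -> R) : set X :=
  [set x | ~ cvgn (birkhoff_average T Phi x)].

Definition bowen_ball (R : realType) (X : metricType R) (T : X -> X)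
    (n : nat) (x : X) (eps : R) : set X :=
  [set y | forall j, (j < n)%N -> mdist (iter j T x) (iter j T y) < eps].

(* A family of balls B_v(x, eps) is encoded by its set of pairs (x, v), so that
   the order v of each ball is part of the data. *)
Definition bowen_covers (R : realType) (X : metricType R) (T : X -> X)
    (E : set X) (n : nat) (eps : R) : set (set (X * nat)) :=
  [set C | [/\ countable C, forall c, C c -> (n <= c.2)%N &
    E `<=` \bigcup_(c in C) bowen_ball T c.2 c.1 eps]].

Definition bowen_sum (R : realType) (X : metricType R) (T : X -> X)
    (E : set X) (t : R) (n : nat) (eps : R) : \bar R :=
  ereal_inf [set \esum_(c in C) (expR (- t * c.2%:R))%:E |
              C in bowen_covers T E n eps].

Definition bowen_outer (R : realType) (X : metricType R) (T : X -> X)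
    (E : set X) (t eps : R) : \bar R :=
  limn (fun n => bowen_sum T E t n eps).

Definition htop_scale (R : realType) (X : metricType R) (T : X -> X)
    (E : set X) (eps : R) : \bar R :=
  ereal_inf [set t%:E | t in [set t : R | bowen_outer T E t eps = 0%E]].

Definition htop (R : realType) (X : metricType R) (T : X -> X)
    (E : set X) : \bar R :=
  lim (htop_scale T E eps @[eps --> 0^'+]).

Definition full_entropy (R : realType) (X : metricType R) (T : X -> X)
    (E : set X) : Prop :=
  htop T E = htop T [set: X].

(* h - eps, with the usual convention that the lower approximations of
   h = +oo are the reals 1/eps (in \bar R, +oo - eps is +oo, and nothing
   exceeds it). *)
Definition below (R : realType) (h : \bar R) (eps : R) : \bar R :=
  if h == +oo%E then (eps^-1)%:E else (h - eps%:E)%E.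

Definition irregular_full (R : realType) (X : metricType R) (T : X -> X) :
    set (C0 X) :=
  [set Phi : C0 X | irregular_set T (C0_fun Phi) !=set0 /\
                    full_entropy T (irregular_set T (C0_fun Phi))].

Definition irregular_above (R : realType) (X : metricType R) (T : X -> X)
    (eps : R) : set (C0 X) :=
  [set Phi : C0 X | irregular_set T (C0_fun Phi) !=set0 /\
    (below (htop T [set: X]) eps < htop T (irregular_set T (C0_fun Phi)))%E].

Lemma nbhs_C0_sup (R : realType) (X : metricType R) (f : C0 X)
    (U : set (C0 X)) (cX : compact [set: X]) :
  nbhs f U <-> exists2 e : R, 0 < e & forall g : C0 X,
    sup [set `|C0_fun f x - C0_fun g x| | x in [set: X]] < e -> U g.
Proof.
have bnd (g : C0 X) : has_ubound [set `|C0_fun f x - C0_fun g x| | x in [set: X]].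
  have cd : continuous (fun x => `|C0_fun f x - C0_fun g x|).
    move=> x; apply: cvg_norm; apply: cvgB.
      exact: (@cts_fun _ _ (f : continuousType X R)).
    exact: (@cts_fun _ _ (g : continuousType X R)).
  have := continuous_compact (continuous_subspaceT cd) cX.
  move=> /compact_bounded[M [_ /(_ (M + 1))]].
  rewrite ltrDl ltr01 => /(_ isT) MB.
  by exists (M + 1) => _ [x _ <-]; have /= := MB _ (imageP _ (I : [set: X] x));
     rewrite normr_id.
rewrite -nbhs_ballE; split => [[e /= e0 eU]|[e e0 eU]].
  exists e => // g fg; apply: eU.
  have : forall x, ball (C0_fun f x) e (C0_fun g x); last by [].
  move=> x; apply: le_lt_trans fg.
  by apply: ub_le_sup; [exact: bnd|exists x].
exists (e / 2); first by rewrite /= divr_gt0.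
move=> g fg.
have {}fg x : ball (C0_fun f x) (e / 2) (C0_fun g x) by exact: fg.
apply: eU; apply: (@le_lt_trans _ _ (e / 2)); last first.
  by rewrite ltr_pdivrMr// ltr_pMr// ltr1n.
have [->|S0] := eqVneq [set `|C0_fun f x - C0_fun g x| | x in [set: X]] set0.
  by rewrite sup0 divr_ge0// ltW.
apply: ge_sup; first exact/set0P.
by move=> _ [x _ <-]; apply/ltW; exact: (fg x).
Qed.

(* Main.v *)
Require Import Defs.
From mathcomp Require Import all_boot all_order all_algebra.
From mathcomp Require Import all_classical all_reals all_analysis.
From mathcomp Require Import borel_hierarchy ring lra zify.
Import Order.TTheory GRing.Theory Num.Theory.
Import numFieldNormedType.Exports.
Local Open Scope classical_set_scope.
Local Open Scope ring_scope.

(** The whole proof lives at one scale and one exponent. A strict lower bound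
    [a < htop T E] is witnessed by some [eps] and some [t > a] at which
    [bowen_outer T E t eps] does not vanish, and at fixed [t] and [eps]
    vanishing is stable under countable unions. Hence [E] may be cut into
    countably many pieces, one of which keeps the bound. Cutting according to
    the cells of a fine partition that an orbit visits infinitely often gives a
    piece whose orbit segments all close up, with boundedly many extra points,
    into pseudo-orbit loops through one common point
    ([exists_recurrent_piece]). The exponent then provides about [exp (t n)]
    separated loops of a common length [n] ([exists_loop_family]). Loops through
    a common point may be concatenated in any order, and shadowing turns each
    concatenation into a true orbit.

    In the other direction, a set containing one point for each sequence of
    symbols, such that different codes lead to separated orbits, has entropy at
    least the logarithm of the number of symbols per unit of time
    ([htop_ge_coding]). If each block consists of a long free word and a short
    forced word of one of two kinds with different Birkhoff sums, and if the two
    kinds alternate in longer and longer runs, then all the points so obtained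
    are irregular, while the forced words cost little entropy
    ([irregular_of_free_loops]).

    Openness: if [irregular_set T Phi] has entropy above [a], some piece of it
    has [Phi]-averages oscillating by a fixed amount. Two long segments of one
    orbit of the piece yield the forced words, and free loops of nearly equal
    [Phi]-averages yield the free words. Only a uniform approximation of [Phi]
    is involved, so every nearby function has an irregular set of entropy above
    [a] ([irregular_set_stable]).

    Density: a point that is irregular for [psi] is irregular for [Phi] or for
    [Phi + s psi], so it is enough to find a single function [psi] whose
    irregular set has entropy above [a]; either [Phi] or a small perturbation
    of it along [psi] inherits the bound. In [exists_irregular_function] one loop
    serves as a marker, the free words are made of the loops that do not
    resemble the marker, and [psi] detects the marker.

    Finally [irregular_full T] is the intersection of the sets
    [irregular_above T (1 / (k + 1))], and Baire's argument in the complete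
    space of continuous functions makes it dense ([C0_baire]). *)

Set Implicit Arguments.
Unset Strict Implicit.
Unset Printing Implicit Defensive.

(** * Strict lower bounds of the entropy *)

Lemma subset_esum (R : realType) (I : choiceType) (A B : set I)
    (a : I -> \bar R) :
  A `<=` B -> (\esum_(i in A) a i <= \esum_(i in B) a i)%E.
Proof.
move=> AB; apply: ereal_sup_le => _ [F [finF FA] <-].
exists F => //; split => //; exact: subset_trans AB.
Qed.

Lemma esum_bigcup_le (R : realType) (I : choiceType) (J : nat -> set I)
    (a : I -> \bar R) : (forall i, 0 <= a i)%E ->
  (\esum_(i in \bigcup_k J k) a i <= \sum_(k <oo) \esum_(i in J k) a i)%E.
Proof.
move=> a0; rewrite seqDU_bigcup_eq (esum_bigcupT _ _ (@trivIset_seqDU _ J))//.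
rewrite nneseries_esumT; last by move=> n; exact: esum_ge0.
apply: le_esum => k _.
by apply: subset_esum; exact: subset_seqDU.
Qed.

Section Entropy.
Context {R : realType} {X : metricType R} (T : X -> X).
Implicit Types (E F : set X) (t eps a : R) (n : nat).

Lemma bowen_sum_ge0 E t n eps : (0 <= bowen_sum T E t n eps)%E.
Proof.
apply: le_ereal_inf_tmp => _ [C _ <-]; apply: esum_ge0 => c _.
by rewrite lee_fin expR_ge0.
Qed.

Lemma bowen_sum_nd E t eps : nondecreasing_seq (bowen_sum T E t ^~ eps).
Proof.
move=> m n mn; apply: ereal_inf_le_tmp => _ [C [cC nC EC] <-].
by exists C => //; split=> // c Cc; exact: leq_trans (nC _ Cc).
Qed.

Lemma bowen_outer_eq0P E t eps :
  bowen_outer T E t eps = 0%E <-> forall n, bowen_sum T E t n eps = 0%E.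
Proof.
rewrite /bowen_outer; have /cvg_lim -> // := ereal_nondecreasing_cvgn (@bowen_sum_nd E t eps).
split=> [h n|h].
  apply/eqP; rewrite eq_le bowen_sum_ge0 andbT -h.
  by apply: ereal_sup_ubound; exists n.
apply/eqP; rewrite eq_le; apply/andP; split.
  by apply: ge_ereal_sup => _ [n _ <-]; rewrite h.
by rewrite -(h 0); apply: ereal_sup_ubound; exists 0.
Qed.

Lemma bowen_sum_eq0P E t n eps : bowen_sum T E t n eps = 0%E <->
  forall d : R, 0 < d -> exists2 C, bowen_covers T E n eps C &
    (\esum_(c in C) (expR (- t * c.2%:R))%:E < d%:E)%E.
Proof.
split=> [h d d0|h].
  have : (bowen_sum T E t n eps < d%:E)%E by rewrite h lte_fin.
  by move=> /ereal_inf_lt[_ [C EC <-] Cd]; exists C.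
apply/eqP; rewrite eq_le bowen_sum_ge0 andbT; apply/lee_addgt0Pr => d d0.
have [C EC Cd] := h _ d0; rewrite add0e.
by apply: le_trans (ltW Cd); apply: ereal_inf_lbound; exists C.
Qed.

Lemma bowen_outer_set0 t eps : bowen_outer T set0 t eps = 0%E.
Proof.
apply/bowen_outer_eq0P => n; apply/bowen_sum_eq0P => d d0.
exists set0; last by rewrite esum_set0 lte_fin.
by split=> //; exact: countable0.
Qed.

Lemma bowen_outer_eq0_le E F t t' eps eps' : E `<=` F -> t <= t' ->
  eps <= eps' ->
  bowen_outer T F t eps = 0%E -> bowen_outer T E t' eps' = 0%E.
Proof.
move=> EF tt' ee' /bowen_outer_eq0P h; apply/bowen_outer_eq0P => n.
apply/bowen_sum_eq0P => d d0; have /bowen_sum_eq0P/(_ _ d0)[C CF Cd] := h n.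
exists C.
  case: CF => cC nC FC; split=> // x /EF/FC[c Cc xc]; exists c => // j jc.
  exact: lt_le_trans (xc _ jc) ee'.
apply: le_lt_trans Cd; apply: le_esum => c _; rewrite lee_fin ler_expR.
by rewrite !mulNr lerN2 ler_wpM2r.
Qed.

(** At a given scale, choose for the [k]-th set a cover of weight below
    [d / 2 ^ (k + 2)]; the union of these covers has weight at most [d / 2]. *)
Lemma bowen_outer_bigcup_nat (E : nat -> set X) t eps :
  (forall k, bowen_outer T (E k) t eps = 0%E) ->
  bowen_outer T (\bigcup_k E k) t eps = 0%E.
Proof.
move=> h; apply/bowen_outer_eq0P => n; apply/bowen_sum_eq0P => d d0.
have dk k : 0 < d / 2 / (2 ^ k.+1)%:R :> R.
  by rewrite !divr_gt0// ltr0n expn_gt0.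
have /choice[C CP] : forall k, exists C, bowen_covers T (E k) n eps C /\
    (\esum_(c in C) (expR (- t * c.2%:R))%:E < (d / 2 / (2 ^ k.+1)%:R)%:E)%E.
  move=> k; have /bowen_outer_eq0P/(_ n)/bowen_sum_eq0P/(_ _ (dk k))[C ? ?] := h k.
  by exists C.
exists (\bigcup_k C k).
  split.
  - by apply: bigcup_countable => // k _; case: (CP k) => -[].
  - by move=> c [k _ kc]; case: (CP k) => -[_ /(_ _ kc)].
  - move=> x [k _ kx]; case: (CP k) => -[_ _ /(_ _ kx)[c kc cx]] _.
    by exists c => //; exists k.
apply: le_lt_trans (_ : _ <= (d / 2)%:E)%E _; last first.
  by rewrite lte_fin ltr_pdivrMr// ltr_pMr// ltr1n.
apply: le_trans (esum_bigcup_le _ _) _.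
  by move=> c; rewrite lee_fin expR_ge0.
apply: le_trans (epsilon_trick0 xpredT (_ : 0 <= d / 2)); last first.
  by rewrite divr_ge0// ltW.
apply: lee_nneseries => [k _ _|k _].
  by apply: esum_ge0 => c _; rewrite lee_fin expR_ge0.
by apply/ltW; case: (CP k).
Qed.

Lemma bowen_outer_bigcup_neq0 (I : countType) (E : I -> set X) t eps :
  bowen_outer T (\bigcup_i E i) t eps <> 0%E ->
  exists i, bowen_outer T (E i) t eps <> 0%E.
Proof.
move=> h; apply: contrapT => /forallNP h'; apply: h.
apply: bowen_outer_eq0_le (_ : _ `<=` \bigcup_k
  (if unpickle k is Some i then E i else set0)) (lexx _) (lexx _) _.
  by move=> x [i _ ix]; exists (pickle i) => //; rewrite pickleK.
apply: bowen_outer_bigcup_nat => k; case: (unpickle k) => [i|].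
  by apply: contrapT; exact: h'.
exact: bowen_outer_set0.
Qed.

Lemma htop_scale_nonincreasing E :
  {in `]0, 1[ &, nonincreasing_fun (htop_scale T E)}.
Proof.
move=> e e' _ _ ee'; apply: ereal_inf_le_tmp => _ [t /= ht <-].
by exists t => //; exact: bowen_outer_eq0_le ht.
Qed.

(** Since [htop] is a supremum over scales of an infimum over exponents, a
    strict lower bound is a statement on a single scale and a single exponent,
    which passes to subsets and pieces. *)
Lemma htop_gtP E a : (a%:E < htop T E)%E <->
  exists t eps, [/\ a < t, 0 < eps & bowen_outer T E t eps <> 0%E].
Proof.
have -> : htop T E = ereal_sup (htop_scale T E @` `]0, 1[).
  apply: cvg_lim => //.
  apply: (@nonincreasing_at_right_cvge _ _ 0 (BLeft 1)).
    by rewrite bnd_simp.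
  exact: htop_scale_nonincreasing.
split.
  move=> /ereal_sup_gt[_ [e /= /andP[e0 _] <-]] h.
  have [t [at_ th]] : exists t : R, a < t /\ (t%:E < htop_scale T E e)%E.
    move: h; case: (htop_scale T E e) => [r||].
    - rewrite lte_fin => ar; exists ((a + r) / 2); rewrite lte_fin.
      by rewrite !midf_lt.
    - by move=> _; exists (a + 1); rewrite ltrDl ltr01 ltry.
    - by [].
  exists t, e; split => // ht; move: th; rewrite ltNge => /negP; apply.
  by apply: ereal_inf_lbound; exists t.
move=> [t [e [at_ e0 h]]].
pose e' := Num.min e (2^-1).
have e'0 : 0 < e' by rewrite /e' lt_min e0 invr_gt0 ltr0n.
apply: (@lt_le_trans _ _ (htop_scale T E e')).
  apply: (@lt_le_trans _ _ t%:E); first by rewrite lte_fin.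
  apply: le_ereal_inf_tmp => _ [s /= hs <-]; rewrite lee_fin leNgt.
  apply/negP => st; apply: h; apply: bowen_outer_eq0_le hs => //; first exact: ltW.
  by rewrite /e' ge_min lexx.
apply: ereal_sup_ubound; exists e' => //=; rewrite in_itv/= e'0/=.
by rewrite /e' gt_min invf_lt1 ?ltr0n// ltr1n orbT.
Qed.

Lemma le_htop E F : E `<=` F -> (htop T E <= htop T F)%E.
Proof.
move=> EF; rewrite leNgt; apply/negP.
suff H a : (a%:E < htop T E)%E -> (a%:E < htop T F)%E.
  case hF : (htop T F) => [r||] //.
  - by move=> /H; rewrite hF ltxx.
  - by move=> /=; rewrite ltNge leey.
  - case hE : (htop T E) => [r||] // _.
      by have := H (r - 1); rewrite hE hF lte_fin ltrBlDr ltrDl ltr01 => /(_ isT).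
    by have := H 0; rewrite hE hF ltry => /(_ isT).
move=> /htop_gtP[t [e [at_ e0 h]]]; apply/htop_gtP; exists t, e; split=> // h'.
by apply: h; exact: bowen_outer_eq0_le h'.
Qed.

Lemma htop_setU_gt E F a : (a%:E < htop T (E `|` F))%E ->
  (a%:E < htop T E)%E \/ (a%:E < htop T F)%E.
Proof.
move=> /htop_gtP[t [e [at_ e0 h]]].
have EF : E `|` F = \bigcup_(b : bool) (if b then E else F).
  apply/seteqP; split=> x; first by case=> ?; [exists true|exists false].
  by case=> -[] _; [left|right].
rewrite EF in h.
by have [[] hb] := bowen_outer_bigcup_neq0 h; [left|right];
   apply/htop_gtP; exists t, e.
Qed.

End Entropy.

(** * Chains, loops and separated sets *)

Lemma pigeonhole_count (I : eqType) (J : finType) (k0 : J) (h : I -> J)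
    (s : seq I) : exists k, (size s <= #|J| * count (fun x => h x == k) s)%N.
Proof.
exists [arg max_(k > k0) count (fun x => h x == k) s].
case: arg_maxnP => // k _ kmax.
have -> : size s = (\sum_(j : J) count (fun x => h x == j) s)%N.
  elim: s {kmax} => [|x s IHs] /=; first by rewrite big1.
  rewrite big_split/= -IHs (bigD1 (h x))//= eqxx big1 ?addn0 ?add1n// => j.
  by rewrite eq_sym => /negbTE ->.
rewrite -sum_nat_const; exact: leq_sum.
Qed.

Section Chains.
Context {R : realType} {X : metricType R} (T : X -> X).
Implicit Types (x y z : X) (s : seq X) (delta : R) (n : nat).

(** The default value [y] of [nth] stands for the point that follows [s], so
    the last jump is the one from the last point of [s] to [y]. *)
Definition chain_to delta s y := forall i, (i < size s)%N ->
  mdist (T (nth y s i)) (nth y s i.+1) < delta.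

(** With the default value [z], the equation covers the empty loop too. *)
Definition pseudo_loop delta z s := nth z s 0 = z /\ chain_to delta s z.

Definition orbit_segment x a b := [seq iter k T x | k <- index_iota a b].

Lemma size_orbit_segment x a b : size (orbit_segment x a b) = (b - a)%N.
Proof. by rewrite size_map size_iota. Qed.

Lemma nth_orbit_segment y x a b i : (i < b - a)%N ->
  nth y (orbit_segment x a b) i = iter (a + i) T x.
Proof. by move=> iab; rewrite (nth_map 0) ?size_iota// nth_iota. Qed.

Lemma chain_to_cat delta s s' y y' : chain_to delta s y -> nth y' s' 0 = y ->
  chain_to delta s' y' -> chain_to delta (s ++ s') y'.
Proof.
move=> sy s'0 s'y' i; rewrite size_cat => iss; rewrite !nth_cat.
have [is_|si] := ltnP i (size s).
  have := sy _ is_; rewrite (set_nth_default y') //.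
  have [is'|si'] := ltnP i.+1 (size s); first by rewrite (set_nth_default y').
  have -> : i.+1 = size s by apply/eqP; rewrite eqn_leq is_ si'.
  by rewrite subnn s'0 (nth_default y (leqnn _)).
by rewrite ltnNge (leqW si)/= subSn//; apply: s'y'; rewrite ltn_subLR.
Qed.

Lemma chain_to_orbit_segment delta x a b y : 0 < delta ->
  mdist (iter b T x) y < delta -> chain_to delta (orbit_segment x a b) y.
Proof.
move=> d0 bxy i; rewrite size_orbit_segment => iab.
rewrite nth_orbit_segment// -iterS -addnS.
have [iab'|] := ltnP i.+1 (b - a); first by rewrite nth_orbit_segment// mdistxx.
move=> h; rewrite nth_default ?size_orbit_segment//.
have -> // : (a + i.+1)%N = b by move: h iab; lia.
Qed.

Lemma pseudo_loop_cat delta z s s' : pseudo_loop delta z s ->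
  pseudo_loop delta z s' -> pseudo_loop delta z (s ++ s').
Proof.
move=> [s0 sz] [s'0 s'z]; split; last exact: chain_to_cat sz s'0 s'z.
by rewrite nth_cat; case: (s) s0 => // _; exact: s'0.
Qed.

Lemma pseudo_loop_flatten delta z ss : (forall s, s \in ss -> pseudo_loop delta z s) ->
  pseudo_loop delta z (flatten ss).
Proof.
elim: ss => [|s ss IHss] h /=; first by split => // i.
apply: pseudo_loop_cat; first by apply: h; rewrite mem_head.
by apply: IHss => s' ss'; apply: h; rewrite inE ss' orbT.
Qed.

Lemma pseudo_orbit_of_loops delta z L (w : nat -> seq X) : (0 < L)%N ->
  (forall k, size (w k) = L) -> (forall k, pseudo_loop delta z (w k)) ->
  pseudo_orbit T delta (fun m => nth z (w (m %/ L)%N) (m %% L)%N).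
Proof.
move=> L0 wL wl m; have [_ /(_ (m %% L)%N)] := wl (m %/ L)%N.
rewrite wL ltn_mod L0 => /(_ isT); congr (_ < _); congr mdist.
have mS : m.+1 = (m %/ L * L + (m %% L).+1)%N by rewrite addnS -divn_eq.
have := ltn_pmod m L0; rewrite leq_eqVlt => /orP[/eqP e|l].
  have -> : (m.+1 %/ L)%N = (m %/ L).+1 by rewrite mS e divnMDl// divnn L0 addn1.
  have -> : (m.+1 %% L)%N = 0 by rewrite mS e modnMDl modnn.
  by rewrite e nth_default ?wL//; have [-> _] := wl (m %/ L).+1.
have -> : (m.+1 %/ L)%N = (m %/ L)%N.
  by rewrite mS divnMDl// (divn_small l) addn0.
by have -> : (m.+1 %% L)%N = (m %% L).+1 by rewrite mS modnMDl modn_small.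
Qed.

Definition bowen_separated n (eps : R) x y :=
  [exists j : 'I_n, eps <= mdist (iter j T x) (iter j T y)].

Lemma bowen_separatedPn n (eps : R) x y :
  ~~ bowen_separated n eps x y -> bowen_ball T n x eps y.
Proof.
by rewrite negb_exists => /forallP h j jn; have := h (Ordinal jn); rewrite -ltNge.
Qed.

(** Covers of [E] by balls of order [n] have weight at least [beta], so the balls
    around fewer than [beta e ^ (t n)] points of [E] miss some point of [E], by
    which a separated set can be enlarged. *)
Lemma exists_separated (E : set X) (t eps : R) : 0 < eps ->
  bowen_outer T E t eps <> 0%E ->
  exists beta : R, 0 < beta /\ exists n1, forall n, (n1 <= n)%N ->
  exists s, [/\ beta * expR (t * n%:R) <= (size s)%:R, forall x, x \in s -> E x &
    pairwise (bowen_separated n eps) s].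
Proof.
move=> eps0 /bowen_outer_eq0P/existsNP[n1 /bowen_sum_eq0P/existsNP[beta]].
move=> /not_implyP[beta0 /forall2NP nC].
exists (beta / 2); split; first exact: divr_gt0.
exists n1 => n n1n.
have H m : m%:R < beta * expR (t * n%:R) + 1 -> exists s,
    [/\ size s = m, forall x, x \in s -> E x & pairwise (bowen_separated n eps) s].
  elim: m => [|m IHm] mb; first by exists [::].
  rewrite -natr1 ltrD2r in mb.
  have [|s [sm sE ss]] := IHm; first by rewrite (lt_le_trans mb)// lerDl.
  have [y Ey ys] : exists2 y, E y & forall x, x \in s -> ~ bowen_ball T n x eps y.
    apply: contrapT => /forall2NP h.
    have [|] := nC [set (x, n) | x in [set` s]]; last first.
      apply; rewrite esum_image; last by move=> x y _ _ [].
      rewrite esum_fset//; last exact: finite_seq.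
      have -> : [set` s] = [set` undup s].
        by apply/seteqP; split => x /=; rewrite mem_undup.
      rewrite -fsbig_seq ?undup_uniq// sumEFin lte_fin /= big_const_seq count_predT.
      rewrite iter_addr_0 mulNr expRN -[X in X < _]mulr_natl ltr_pdivrMr ?expR_gt0//.
      by apply: le_lt_trans mb; rewrite -sm ler_nat size_undup.
    apply; split.
    - by apply: finite_set_countable; exact: finite_image.
    - by move=> _ [x _ <-].
    - move=> y Ey; have [//|/existsNP[x /not_implyP[xs /contrapT xy]]] := h y.
      by exists (x, n) => //; exists x.
  exists (rcons s y); rewrite size_rcons sm; split => // [x|].
    by rewrite mem_rcons inE => /orP[/eqP -> //|]; exact: sE.
  rewrite pairwise_rcons ss andbT; apply/allP => x xs.
  by apply: contrapT => /negP/bowen_separatedPn; exact: ys.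
have bt0 : 0 < beta / 2 * expR (t * n%:R) by rewrite mulr_gt0 ?expR_gt0 ?divr_gt0.
have /andP[trle trgt] := truncn_itv (ltW bt0).
have [] := H (Num.truncn (beta / 2 * expR (t * n%:R))).+1.
  rewrite -natr1 ltrD2r; apply: (le_lt_trans trle).
  by rewrite ltr_pM2r ?expR_gt0// ltr_pdivrMr// ltr_pMr// ltr1n.
by move=> s [sm sE ss]; exists s; split => //; rewrite sm; exact: ltW.
Qed.

End Chains.

(** * Loops from entropy *)

Section LoopFamilies.
Context {R : realType} {X : metricType R} (T : X -> X).
Hypothesis X_compact : compact [set: X].
Implicit Types (x y z : X) (s : seq X) (delta : R) (n : nat).

(** Sending each point to a nearby point of a finite net partitions [X] into
    finitely many cells of small diameter. *)
Lemma finite_cells (rho : R) : 0 < rho -> exists l (cell : X -> 'I_l),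
  forall x y, cell x = cell y -> mdist x y < rho.
Proof.
move=> rho0; have r20 : 0 < rho / 2 by rewrite divr_gt0.
pose P s x := exists2 c, c \in s & mdist c x < rho / 2.
pose F := filter_from [set: seq X] (fun s => [set s' : seq X | {subset s <= s'}]).
have FF : Filter F.
  apply: filter_from_filter; first by exists [::].
  move=> s s' _ _; exists (s ++ s') => // r sr.
  by split=> x xs; apply: sr; rewrite mem_cat xs ?orbT.
have [s _ /(_ s (fun=> id)) sP] : \near F, [set: X] `<=` P F.
  move/compact_near_coveringP: X_compact; apply => x _.
  exists (ball x (rho / 2), [set s' : seq X | {subset [:: x] <= s'}]).
    by split; [exact: nbhsx_ballx|exists [:: x]].
  move=> [y s] /= []; rewrite ballEmdist => xy xs.
  by exists x => //; apply: xs; rewrite mem_head.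
have /choice[cell cellP] : forall x, exists i : 'I_(size s),
    mdist (tnth (in_tuple s) i) x < rho / 2.
  move=> x; have [c cs' cx] := sP x I.
  have cs : (index c s < size s)%N by rewrite index_mem.
  by exists (Ordinal cs); rewrite (tnth_nth c) /= nth_index.
exists (size s), cell => x y xy.
have := ltrD (cellP x) (cellP y); rewrite -splitr xy; apply: le_lt_trans.
rewrite [X in _ <= X + _]metric_sym; exact: metric_triangle.
Qed.

(** The piece gathers the points that visit from time [K] on only the cells of
    [S], and each of them infinitely often. Cells being of diameter less than
    [delta], an orbit may jump to another one inside a cell. The orbit of one
    point [x0] of the piece thus leads from [z] to the cell where a segment
    starts, and back to the cell of [z] from the one where it ends. *)
Lemma exists_recurrent_piece (E : set X) (t eps delta : R) : 0 < delta ->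
  bowen_outer T E t eps <> 0%E ->
  exists (E' : set X) (K l : nat) (cell : X -> 'I_l) z (p q : 'I_l -> seq X),
  [/\ E' `<=` E, bowen_outer T E' t eps <> 0%E &
    forall x, E' x -> forall m, (K < m)%N -> pseudo_loop T delta z
      (p (cell (iter K T x)) ++ orbit_segment T x K m ++ q (cell (iter m T x)))].
Proof.
move=> d0 outerE.
have [l [cell cellP]] := finite_cells d0.
pose P (KS : nat * {set 'I_l}) : set X := [set x | [/\ E x,
  forall k, (KS.1 <= k)%N -> cell (iter k T x) \in KS.2 &
  forall i, i \in KS.2 -> forall N, exists2 k, (N <= k)%N & cell (iter k T x) = i]].
have EP : E `<=` \bigcup_KS P KS.
  move=> x Ex; pose io i := forall N, exists2 k, (N <= k)%N & cell (iter k T x) = i.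
  have /choice[M MP] : forall i, exists M, ~ io i ->
      forall k, (M <= k)%N -> cell (iter k T x) != i.
    move=> i; have [?|/existsNP[M hM]] := pselect (io i); first by exists 0.
    exists M => _ k Mk; apply/eqP => ki; apply: hM; by exists k.
  exists (\max_i M i, [set i | `[< io i >]])%SET => //; split => //= [k Mk|i].
    rewrite inE; apply/asboolP; apply: contrapT => /MP/(_ k).
    rewrite (leq_trans _ Mk) ?leq_bigmax// => /(_ isT)/eqP; exact.
  by rewrite inE => /asboolP.
have [[K S]] : exists KS, bowen_outer T (P KS) t eps <> 0%E.
  apply: bowen_outer_bigcup_neq0 => h; apply: outerE.
  exact: bowen_outer_eq0_le h.
set E' := P (K, S) => outerE'.
have [x0 [Ex0 x0S Srec]] : E' !=set0.
  apply/set0P/eqP => E'0; apply: outerE'.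
  by rewrite E'0 bowen_outer_set0.
pose z := iter K T x0.
have /choice[b bP] : forall i, exists b, i \in S ->
    (K < b)%N /\ cell (iter b T x0) = i.
  move=> i; have [iS|iS] := boolP (i \in S); last by exists 0.
  by have [b Kb bi] := Srec _ iS K.+1; exists b.
have [e eb ez] := Srec _ (x0S K (leqnn _)) (\max_i b i).+1.
exists E', K, l, cell, z, (fun i => orbit_segment T x0 K (b i)),
  (fun i => orbit_segment T x0 (b i) e).
split => // [x [] //|x [_ xS _] m Km].
have [Kb1 cb1] := bP _ (xS K (leqnn _)).
have [_ cb2] := bP _ (xS m (ltnW Km)).
have be i : (b i < e)%N by rewrite (leq_ltn_trans _ eb)// leq_bigmax.
split.
  by rewrite nth_cat size_orbit_segment subn_gt0 Kb1 nth_orbit_segment ?addn0 ?subn_gt0.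
apply: (@chain_to_cat _ _ _ _ _ _ (iter K T x)).
- by apply: chain_to_orbit_segment => //; apply: cellP; rewrite cb1.
- by rewrite nth_cat size_orbit_segment subn_gt0 Km nth_orbit_segment ?addn0 ?subn_gt0.
apply: (@chain_to_cat _ _ _ _ _ _ (iter (b (cell (iter m T x))) T x0)).
- by apply: chain_to_orbit_segment => //; apply: cellP; rewrite cb2.
- by rewrite nth_orbit_segment ?addn0 ?subn_gt0.
by apply: chain_to_orbit_segment => //; apply: cellP; rewrite ez.
Qed.

(** The growth rate [t' < t] absorbs all the constant factors: the pigeonhole
    on finitely many classes makes the loops equally long, equal up to [eps]
    before time [K], and of nearly the same [Phi]-average. *)
Lemma exists_loop_family (E : set X) (t t' eps delta kappa B : R) (Phi : X -> R)
    (K l : nat) (cell : X -> 'I_l) z (p q : 'I_l -> seq X) :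
  0 < eps -> t' < t -> 0 < kappa -> (forall x, `|Phi x| <= B) ->
  bowen_outer T E t eps <> 0%E ->
  (forall x, E x -> forall m, (K < m)%N -> pseudo_loop T delta z
    (p (cell (iter K T x)) ++ orbit_segment T x K m ++ q (cell (iter m T x)))) ->
  forall n1, exists n (A : R) N (F : 'I_N -> seq X), [/\ (n1 <= n)%N,
    expR (t' * n%:R) <= N%:R,
    forall i, size (F i) = n /\ pseudo_loop T delta z (F i),
    forall i, A * n%:R <= \sum_(x <- F i) Phi x <= (A + kappa) * n%:R &
    forall i j, i != j -> exists2 k, (k < n)%N &
      eps <= mdist (nth z (F i) k) (nth z (F j) k)].
Proof.
move=> eps0 tt' kappa0 PhiB outerE loopE n1.
have [beta [beta0 [n0 sepE]]] := exists_separated eps0 outerE.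
have [l' [cell' cell'P]] := finite_cells eps0.
pose bins := (Num.truncn (2 * B / kappa)).+1.
pose u n x := p (cell (iter K T x)) ++ orbit_segment T x K n ++ q (cell (iter n T x)).
pose avg n x := (size (u n x))%:R^-1 * \sum_(y <- u n x) Phi y.
pose J : finType := ({ffun 'I_K -> 'I_l'} * 'I_l * 'I_l * 'I_bins)%type.
pose h n x : J := ([ffun k : 'I_K => cell' (iter k T x)], cell (iter K T x),
  cell (iter n T x), inord (Num.truncn ((avg n x + B) / kappa))).
pose C := (K + \max_i size (p i) + \max_i size (q i))%N.
have usize n x : (K <= n)%N -> (n <= size (u n x) + C)%N /\ (size (u n x) <= n + C)%N.
  move=> Kn; rewrite /u !size_cat size_orbit_segment.
  have pC : (size (p (cell (iter K T x))) <= \max_i size (p i))%N.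
    exact: (@leq_bigmax _ (fun i => size (p i))).
  have qC : (size (q (cell (iter n T x))) <= \max_i size (q i))%N.
    exact: (@leq_bigmax _ (fun i => size (q i))).
  by rewrite /C; split; lia.
have M0 : (0 < #|J|)%N -> 0 < #|J|%:R :> R by rewrite ltr0n.
pose c := (`|t'| * C%:R + ln #|J|%:R - ln beta) / (t - t').
pose n := (n0 + K + n1 + C + 1 + (Num.truncn c).+1)%N.
have [n0n Kn n1n] : [/\ n0 <= n, K < n & n1 + C + 1 <= n]%N.
  by rewrite /n; split; lia.
have cn : c < n%:R.
  by apply: lt_le_trans (truncnS_gt c) _; rewrite ler_nat leq_addl.
have [s [sbeta sE ssep]] := sepE n n0n.
have s0 : (0 < size s)%N.
  by rewrite -(ltr_nat R) (lt_le_trans _ sbeta)// mulr_gt0 ?expR_gt0.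
have x0 : X by case: (s) s0.
have [k sk] := pigeonhole_count (h n x0) (h n) s.
pose ys := [seq x <- s | h n x == k].
have sys : (size s <= #|J| * size ys)%N by rewrite size_filter.
have /andP[J0 ys0] : (0 < #|J|)%N && (0 < size ys)%N.
  by rewrite -muln_gt0 (leq_trans s0).
have ysP y : y \in ys -> E y /\ h n y = k.
  by rewrite mem_filter => /andP[/eqP -> /sE].
pose y0 := nth x0 ys 0; have y0ys : y0 \in ys by rewrite mem_nth.
pose n' := size (u n y0).
have ysize y : y \in ys -> size (u n y) = n'.
  move=> /ysP[_ hy]; have [_] := ysP _ y0ys; rewrite -hy /h => -[_ e1 e2 _].
  by rewrite /n' /u !size_cat !size_orbit_segment e1 e2.
have [nn' n'n] := usize n y0 (ltnW Kn); rewrite -/n' in nn' n'n.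
have n'0 : (0 < n')%N by move: nn' n1n; lia.
have n'R : 0 < n'%:R :> R by rewrite ltr0n.
pose A := - B + kappa * (nat_of_ord k.2)%:R.
exists n', A, (size ys), (fun i => u n (tnth (in_tuple ys) i)).
have tys i : tnth (in_tuple ys) i \in ys by exact: mem_tnth.
split.
- by move: nn' n1n; lia.
- have NJ : expR (ln beta + t * n%:R - ln #|J|%:R) <= (size ys)%:R.
    rewrite expRD expRN !lnK ?posrE ?M0// expRD lnK ?posrE//.
    rewrite ler_pdivrMr ?M0// (le_trans sbeta)// -natrM ler_nat mulnC//.
  apply: le_trans NJ; rewrite ler_expR.
  have t'n' : t' * n'%:R <= t' * n%:R + `|t'| * C%:R.
    rewrite -lerBlDl -mulrBr (le_trans (ler_norm _))// normrM ler_wpM2l//.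
    have r1 : n'%:R <= n%:R + C%:R :> R by rewrite -natrD ler_nat.
    have r2 : n%:R <= n'%:R + C%:R :> R by rewrite -natrD ler_nat.
    by rewrite ler_norml; apply/andP; split; lra.
  move: cn; rewrite ltr_pdivrMr ?subr_gt0// => cn.
  by move: t'n' cn; lra.
- by move=> i; rewrite (ysize _ (tys i)); split=> //; apply: loopE => //; case: (ysP _ (tys i)).
- move=> i; set y := tnth _ i; have [_ hy] := ysP _ (tys i); rewrite -/y in hy.
  have -> : \sum_(x <- u n y) Phi x = avg n y * n'%:R.
    by rewrite /avg (ysize _ (tys i)) mulrAC mulVf ?mul1r// gt_eqF.
  rewrite !ler_pM2r//.
  have avgB : `|avg n y| <= B.
    rewrite /avg (ysize _ (tys i)) normrM normfV normr_nat ler_pdivrMl//.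
    apply: le_trans (ler_norm_sum _ _ _) _.
    apply: le_trans (ler_sum _ (fun i _ => PhiB i)) _.
    by rewrite big_const_seq count_predT iter_addr_0 (ysize _ (tys i)) mulr_natl.
  move: avgB; rewrite ler_norml => /andP[avgB1 avgB2].
  have bk0 : 0 <= (avg n y + B) / kappa by apply: divr_ge0; [move: avgB1; lra|exact: ltW].
  have -> : A = - B + kappa * (Num.truncn ((avg n y + B) / kappa))%:R.
    rewrite /A -hy /h /= inordK// /bins ltnS; apply: le_truncn.
    by rewrite ler_pM2r ?invr_gt0// mulr2n; lra.
  have /andP[] := truncn_itv bk0.
  rewrite -natr1 ler_pdivlMr// ltr_pdivrMr//.
  by move: (Num.truncn _) => b; lra.
- have H i j : (i < j)%N -> (j < size ys)%N -> exists2 k0, (k0 < n')%N &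
      eps <= mdist (nth z (u n (nth x0 ys i)) k0) (nth z (u n (nth x0 ys j)) k0).
    move=> ij jys; have iys := ltn_trans ij jys.
    have [Ei hi] := ysP _ (mem_nth x0 iys); have [Ej hj] := ysP _ (mem_nth x0 jys).
    have /pairwiseP : pairwise (bowen_separated T n eps) ys.
      exact: subseq_pairwise (filter_subseq _ _) ssep.
    move=> /(_ x0 i j iys jys ij) /existsP[[k0 k0n]] /= kij.
    have := etrans hi (esym hj); rewrite /h => -[/ffunP hK e1 e2 _].
    have Kk0 : (K <= k0)%N.
      rewrite leqNgt; apply/negP => k0K; move: kij; rewrite leNgt => /negP; apply.
      by apply: cell'P; have := hK (Ordinal k0K); rewrite !ffunE.
    have kK : (k0 - K < n - K)%N by rewrite ltn_sub2r.
    exists (size (p (cell (iter K T (nth x0 ys i)))) + (k0 - K))%N.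
      rewrite -(ysize _ (mem_nth x0 iys)) /u !size_cat size_orbit_segment.
      by rewrite ltn_add2l ltn_addr.
    rewrite /u -e1 !nth_cat ltnNge leq_addr/= addKn size_orbit_segment kK.
    by rewrite !nth_orbit_segment ?size_orbit_segment ?kK// subnKC.
  move=> i j ij; rewrite !(tnth_nth x0) /=.
  have := ij; rewrite -val_eqE /= neq_ltn => /orP[ij'|ji]; first exact: H.
  have [k0 k0n kij] := H _ _ ji (ltn_ord i).
  by exists k0 => //; rewrite metric_sym.
Qed.

End LoopFamilies.

(** * Entropy from symbolic coding *)

Lemma truncn_mulVn (R : realType) (x : R) N : (0 < N)%N -> 0 <= x ->
  Num.truncn x = (Num.truncn (x * N%:R) %/ N)%N.
Proof.
move=> N0 x0; have N0R : 0 < N%:R :> R by rewrite ltr0n.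
have xN0 : 0 <= x * N%:R by rewrite mulr_ge0.
have /andP[] := truncn_itv xN0; set m := Num.truncn _ => mx xm.
apply: truncn_def; apply/andP; split.
  rewrite -(ler_pM2r N0R) (le_trans _ mx)// -natrM ler_nat; exact: leq_divM.
rewrite -(ltr_pM2r N0R) (lt_le_trans xm)// -natrM ler_nat.
by rewrite ltn_ceil.
Qed.

Lemma ge0_le_esumZl (R : realType) (I : choiceType) (C : set I) (k : R)
    (a : I -> R) : 0 <= k -> (forall i, 0 <= a i) ->
  (\esum_(i in C) (k * a i)%:E <= k%:E * \esum_(i in C) (a i)%:E)%E.
Proof.
move=> k0 a0; apply: ge_ereal_sup => _ [F [finF FC] <-].
rewrite fsbig_finite//=; under eq_bigr do rewrite EFinM.
rewrite -ge0_sume_distrr; last by move=> i _; rewrite lee_fin.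
rewrite lee_wpmul2l ?lee_fin//.
rewrite -fsbig_finite//; apply: ereal_sup_ubound; by exists F.
Qed.

(** The index type may be uncountable, so the intervals are listed along an
    injection of [C] into the natural numbers. *)
Lemma lebesgue_countable_cover (R : realType) (I0 : choiceType) (C : set I0)
    (A : set R) (J : I0 -> set R) :
  countable C -> measurable A -> (forall c, measurable (J c)) ->
  A `<=` \bigcup_(c in C) J c ->
  (lebesgue_measure A <= \esum_(c in C) lebesgue_measure (J c))%E.
Proof.
move=> /countable_injP[f finj] mA mJ AJ.
pose mu := @lebesgue_measure R.
have /choice[s sP] : forall n, exists o : option I0, forall c,
    o = Some c <-> C c /\ f c = n.
  move=> n; have [[c [Cc fc]]|h] := pselect (exists c, C c /\ f c = n).
    exists (Some c) => d; split => [[<-]//|[Cd fd]]; congr Some.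
    by apply: finj; rewrite ?inE// fc fd.
  by exists None => d; split => // -[Cd fd]; case: h; exists d.
pose F n := if s n is Some c then J c else set0.
have mF n : measurable (F n) by rewrite /F; case: (s n).
have AF : A `<=` \bigcup_n F n.
  move=> x /AJ[c Cc Jx]; exists (f c) => //; rewrite /F.
  by have /sP -> : C c /\ f c = f c.
apply: (le_trans (measure_sigma_subadditive lebesgue_measure mF mA AF)).
rewrite nneseries_esumT//.
have -> : (\esum_(n in [set: nat]) mu (F n) = \esum_(n in f @` C) mu (F n))%E.
  rewrite [RHS]esum_mkcond; apply: eq_esum => n _; case: ifPn => //.
  rewrite notin_setE => nC; rewrite /F; case E : (s n) => [c|]; last exact: measure0.
  by have [Cc fc] := (sP n c).1 E; exfalso; apply: nC; exists c.
rewrite esum_image; last exact: finj.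
apply: le_esum => c Cc; rewrite /F.
by have /sP -> : C c /\ f c = f c.
Qed.

Section Coding.
Context {R : realType} {X : metricType R} (T : X -> X).

(** Base-[#|G|] digits turn a real of [0, 1[ into a sequence of symbols. A ball
    of order [v] meets only points whose first [v / L] digits agree, hence
    pulls back into an interval of length [#|G| ^ - (v / L)]; as these
    intervals cover [0, 1[, their lengths add up to at least 1. At exponent
    [ln #|G| / L] a length is at most [#|G|] times the weight of the ball, which
    bounds the weight of the cover from below. *)
Lemma htop_ge_coding (E : set X) (G : finType) (L : nat) (eta : R)
    (y : (nat -> G) -> X) : (0 < #|G|)%N -> (0 < L)%N -> 0 < eta ->
  (forall g, E (y g)) ->
  (forall g g' k, g k <> g' k -> exists2 j, (j < L * k.+1)%N &
    2 * eta <= mdist (iter j T (y g)) (iter j T (y g'))) ->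
  ((ln #|G|%:R / L%:R)%:E <= htop T E)%E.
Proof.
move=> N0 L0 eta0 Ey sepy; set N := #|G| in N0 *; set t := _ / _.
suff outerE : bowen_outer T E t eta <> 0%E.
  have H a : a < t -> (a%:E < htop T E)%E.
    by move=> at_; apply/htop_gtP; exists t, eta.
  case hE : (htop T E) => [r||]; last 2 first.
  - by rewrite leey.
  - by have := H (t - 1); rewrite hE ltrBlDr ltrDl ltr01 => /(_ isT).
  rewrite lee_fin leNgt; apply/negP => rt.
  by have := H r rt; rewrite hE ltxx.
have N0R : 0 < N%:R :> R by rewrite ltr0n.
move=> /bowen_outer_eq0P/(_ 0%N)/bowen_sum_eq0P/(_ N%:R^-1).
rewrite invr_gt0 => /(_ N0R)[C [cC _ EC]]; apply/negP; rewrite -leNgt.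
pose A k (x : R) := Num.truncn (x * N%:R ^+ k).
have AS k x : 0 <= x -> A k x = (A k.+1 x %/ N)%N.
  move=> x0; rewrite /A exprSr mulrA; apply: truncn_mulVn => //.
  by rewrite mulr_ge0// exprn_ge0.
have dN k x : (A k.+1 x %% N < N)%N by rewrite ltn_mod.
pose g x k : G := enum_val (Ordinal (dN k x)).
pose J (c : X * nat) (q : nat) : set R :=
  [set` `[q%:R / N%:R ^+ (c.2 %/ L), q.+1%:R / N%:R ^+ (c.2 %/ L)[].
have /choice[q qP] : forall c : X * nat, exists q, forall x, 0 <= x < 1 ->
    bowen_ball T c.2 c.1 eta (y (g x)) -> J c q x.
  move=> c; have [[x [x01 cx]]|h] := pselect (exists x, 0 <= x < 1 /\
      bowen_ball T c.2 c.1 eta (y (g x))); last first.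
    by exists 0%N => x x01 cx; case: h; exists x.
  exists (A (c.2 %/ L)%N x) => x' x'01 cx'.
  have x0 : 0 <= x by case/andP : x01.
  have x'0 : 0 <= x' by case/andP : x'01.
  have gk k : (k < c.2 %/ L)%N -> g x k = g x' k.
    move=> kl; apply: contrapT => /sepy[j jk]; apply/negP; rewrite -ltNge.
    have jc : (j < c.2)%N.
      apply: leq_trans jk _; apply: leq_trans (leq_divM c.2 L).
      by rewrite mulnC leq_mul2r kl orbT.
    apply: (le_lt_trans (metric_triangle _ (iter j T c.1) _)).
    by rewrite mulr_natl mulr2n ltrD//; [rewrite metric_sym; exact: cx|exact: cx'].
  have -> : A (c.2 %/ L)%N x = A (c.2 %/ L)%N x'.
    elim: (c.2 %/ L)%N gk => [|k IHk] gk.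
      rewrite /A !expr0 !mulr1.
      by rewrite (@truncn_def _ x 0) ?(@truncn_def _ x' 0).
    rewrite (divn_eq (A k.+1 x) N) (divn_eq (A k.+1 x') N) -!AS// IHk.
      by have /enum_val_inj/(congr1 val)/= -> := gk k (ltnSn k).
    by move=> i ik; apply: gk; exact: ltnW.
  have Nl : 0 < N%:R ^+ (c.2 %/ L) :> R by rewrite exprn_gt0.
  rewrite /J /= in_itv /= ler_pdivrMr// ltr_pdivlMr//.
  by apply: truncn_itv; rewrite mulr_ge0// ltW.
have cov : ([set` `[0, 1[] : set R) `<=` \bigcup_(c in C) J c (q c).
  move=> x /=; rewrite in_itv/= => x01; have [c Cc xc] := EC _ (Ey (g x)).
  by exists c => //; exact: qP.
have mJ c : measurable (J c (q c)) by exact: measurable_itv.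
have muJ c : (lebesgue_measure (J c (q c)) <= (N%:R * expR (- t * c.2%:R))%:E)%E.
  have Nl : 0 < N%:R ^+ (c.2 %/ L) :> R by rewrite exprn_gt0.
  rewrite /J lebesgue_measure_itv/= lte_fin ltr_pM2r ?invr_gt0// ltr_nat ltnSn.
  rewrite -EFinB lee_fin -mulrBl -natrB// subSnn mul1r.
  have -> : (N%:R ^+ (c.2 %/ L))^-1 = expR (- ln N%:R * (c.2 %/ L)%:R) :> R.
    by rewrite mulNr expRN expRM_natr lnK ?posrE.
  rewrite -[X in _ <= X * _](@lnK _ N%:R) ?posrE// -expRD ler_expR /t.
  have lnN : 0 <= ln N%:R :> R by rewrite ln_ge0// ler1n.
  rewrite -subr_ge0; set v := c.2.
  have -> : ln N%:R + - (ln N%:R / L%:R) * v%:R - - ln N%:R * (v %/ L)%:R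
      = ln N%:R * (1 + (v %/ L)%:R - v%:R / L%:R) :> R by ring.
  rewrite mulr_ge0// subr_ge0 ler_pdivrMr ?ltr0n// nat1r -natrM ler_nat.
  by apply: ltnW; exact: ltn_ceil.
have := lebesgue_countable_cover cC (measurable_itv _) mJ cov.
rewrite lebesgue_measure_itv /= lte_fin ltr01 oppr0 adde0 => /le_trans.
move=> /(_ _ (le_esum (fun c _ => muJ c))).
move=> /le_trans/(_ (ge0_le_esumZl _ (ltW N0R) (fun c => expR_ge0 _))).
by rewrite -lee_pdivrMl// mule1.
Qed.

End Coding.

(** * Irregular points from alternating blocks *)

Lemma sum_blocks (R : realType) (u : nat -> R) L m :
  \sum_(0 <= i < m * L) u i =
  \sum_(0 <= k < m) \sum_(0 <= i < L) u (k * L + i)%N.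
Proof.
elim: m => [|m IHm]; first by rewrite mul0n !big_geq.
rewrite mulSnr (@big_cat_nat _ _ _ (m * L)%N) ?leq_addr//= IHm big_nat_recr//=.
congr (_ + _); rewrite -{1}(add0n (m * L)%N) big_addn addKn.
by apply: eq_bigr => i _; rewrite addnC.
Qed.

(** The blocks before [b ^ j] make up a fraction [1 / b] of those before
    [b ^ j.+1], whatever [j]. *)
Lemma average_blocks_ge (R : realType) (u : nat -> R) (A B : R) L b j :
  (0 < L)%N -> (0 < b)%N -> (forall i, `|u i| <= B) ->
  (forall k, (b ^ j <= k < b ^ j.+1)%N ->
     L%:R * A <= \sum_(0 <= i < L) u (k * L + i)%N) ->
  A - (`|A| + B) / b%:R <=
  (b ^ j.+1 * L)%N%:R^-1 * \sum_(0 <= i < b ^ j.+1 * L) u i.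
Proof.
move=> L0 b0 uB uA; have bj : (b ^ j <= b ^ j.+1)%N by rewrite leq_pexp2l.
have LR : 0 < L%:R :> R by rewrite ltr0n.
have bR : 0 < b%:R :> R by rewrite ltr0n.
have bjR : 0 < b%:R ^+ j :> R by rewrite exprn_gt0.
rewrite ler_pdivlMl ?ltr0n ?muln_gt0 ?expn_gt0 ?b0//.
rewrite sum_blocks (@big_cat_nat _ _ _ (b ^ j)%N)//=.
have h1 : - ((b ^ j * L)%N%:R * B) <=
    \sum_(0 <= k < b ^ j) \sum_(0 <= i < L) u (k * L + i)%N.
  rewrite -sum_blocks lerNl -sumrN.
  rewrite mulr_natl -[X in _ *+ X]subn0 -sumr_const_nat; apply: ler_sum => i _.
  by rewrite (le_trans (ler_norm _))// normrN.
have h2 : (b ^ j.+1 - b ^ j)%N%:R * (L%:R * A) <=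
    \sum_(b ^ j <= k < b ^ j.+1) \sum_(0 <= i < L) u (k * L + i)%N.
  rewrite mulr_natl -sumr_const_nat big_nat_cond [leRHS]big_nat_cond.
  by apply: ler_sum => k; rewrite andbT => /uA.
apply: le_trans (lerD h1 h2).
rewrite natrB// !natrM !natrX exprS.
rewrite -subr_ge0.
have -> : - (b%:R ^+ j * L%:R * B) + (b%:R * b%:R ^+ j - b%:R ^+ j) * (L%:R * A)
    - b%:R * b%:R ^+ j * L%:R * (A - (`|A| + B) / b%:R)
    = b%:R ^+ j * L%:R * (`|A| - A).
  by field; rewrite gt_eqF.
by rewrite !mulr_ge0 ?subr_ge0 ?ler_norm// ltW.
Qed.

Section IrregularPoints.
Context {R : realType} {X : metricType R} (T : X -> X).

(** The [k]-th block is of the first or the second kind according to the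
    parity of [trunc_log b k]: a run of one kind is [b - 1] times as long as
    everything before it, so the averages at the ends of the runs keep
    alternating. *)
Lemma alternating_blocks_irregular (Phi : X -> R) (A B c : R) L b y :
  (0 < L)%N -> (1 < b)%N -> 0 < c -> (forall x, `|Phi x| <= B) ->
  (`|A| + c + B) / b%:R <= c / 4 ->
  (forall k, let S := \sum_(0 <= i < L) Phi (iter (k * L + i) T y) in
     if odd (trunc_log b k) then L%:R * (A + c) <= S else S <= L%:R * A) ->
  irregular_set T Phi y.
Proof.
move=> L0 b1 c0 PhiB bc blk /= /cvgrPdist_lt/(_ (c / 4)).
rewrite divr_gt0// => /(_ isT) [N _ NP]; set l := lim _ in NP.
have b0 : (0 < b)%N by exact: ltnW.
have bR : 0 < b%:R :> R by rewrite ltr0n.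
pose t j := (b ^ j.+1 * L)%N.
have tN j : (N <= j)%N -> `|l - birkhoff_average T Phi y (t j)| < c / 4.
  move=> Nj; apply: NP => /=; apply: leq_trans Nj _.
  rewrite /t (leq_trans (ltnW (ltn_expl j b1)))//.
  by rewrite (leq_trans _ (leq_pmulr _ L0))// leq_exp2l.
have tlog j k : (b ^ j <= k < b ^ j.+1)%N -> trunc_log b k = j.
  by move=> jk; apply: trunc_log_eq.
have hodd : A + c - c / 4 <= birkhoff_average T Phi y (t N.*2.+1).
  apply: le_trans (@average_blocks_ge _ (fun i => Phi (iter i T y)) (A + c) B
     _ _ _ L0 b0 _ _) => //.
    rewrite lerD2l lerN2; apply: le_trans bc.
    by rewrite ler_pM2r ?invr_gt0// lerD2r (le_trans (ler_normD _ _))// (ger0_norm (ltW c0)).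
  by move=> k /tlog kN; have /= := blk k; rewrite kN /= odd_double.
have heven : birkhoff_average T Phi y (t N.*2) <= A + c / 4.
  have : - A - c / 4 <= - birkhoff_average T Phi y (t N.*2).
    rewrite /birkhoff_average -[leRHS]mulrN -sumrN.
    apply: le_trans (@average_blocks_ge _ (fun i => - Phi (iter i T y)) (- A) B
     _ _ _ L0 b0 _ _).
    - rewrite lerD2l lerN2; apply: le_trans bc.
      by rewrite ler_pM2r ?invr_gt0// lerD2r normrN lerDl ltW.
    - by move=> i; rewrite normrN.
    move=> k /tlog kN; have /= := blk k; rewrite kN odd_double sumrN mulrN.
    by rewrite lerN2.
  lra.
have n1 : (N <= N.*2.+1)%N by lia.
have n2 : (N <= N.*2)%N by lia.
have := tN _ n1; have := tN _ n2; rewrite !ltr_norml => /andP[? ?] /andP[? ?].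
lra.
Qed.

(** The alphabet is free in each block, the kind of the block is dictated by the
    schedule. The condition on Birkhoff sums bears on the block at time 0 of an
    arbitrary shadowing point, and shifting transfers it to all blocks; as it
    has access to the whole sequence of blocks, the function may look beyond the
    end of the block. Separation by [4 * eta] leaves [2 * eta] after two
    shadowing errors, the width of a ball of radius [eta]. *)
Lemma irregular_of_loop_blocks (Phi : X -> R) (B : R) (G : finType) L z
    (w : G -> bool -> seq X) (delta eta eta0 A c : R) :
  (0 < L)%N -> (0 < #|G|)%N -> 0 < eta -> 4 * eta <= eta0 -> 0 < c ->
  (forall x, `|Phi x| <= B) ->
  (forall x, pseudo_orbit T delta x ->
     exists y, forall n, mdist (iter n T y) (x n) < eta) ->
  (forall g e, size (w g e) = L /\ pseudo_loop T delta z (w g e)) ->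
  (forall g g' e, g <> g' -> exists2 i, (i < L)%N &
     eta0 <= mdist (nth z (w g e) i) (nth z (w g' e) i)) ->
  (forall (g : nat -> G) (e : nat -> bool) y,
     (forall k i, (i < L)%N ->
        mdist (iter (k * L + i) T y) (nth z (w (g k) (e k)) i) < eta) ->
     let S := \sum_(0 <= i < L) Phi (iter i T y) in
     if e 0 then L%:R * (A + c) <= S else S <= L%:R * A) ->
  irregular_set T Phi !=set0 /\
  ((ln #|G|%:R / L%:R)%:E <= htop T (irregular_set T Phi))%E.
Proof.
move=> L0 G0 eta_gt0 eta4 c0 PhiB sh wL wsep blk.
pose b := (Num.truncn ((`|A| + c + B) / (c / 4))).+2.
have b1 : (1 < b)%N by [].
have bc : (`|A| + c + B) / b%:R <= c / 4.
  have c4 : 0 < c / 4 by rewrite divr_gt0.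
  rewrite ler_pdivrMr ?ltr0n// mulrC -ler_pdivrMr//; apply/ltW.
  by apply: lt_trans (truncnS_gt _) _; rewrite ltr_nat.
pose e k := odd (trunc_log b k).
have /choice[y yP] : forall g : nat -> G, exists y, forall k i, (i < L)%N ->
    mdist (iter (k * L + i) T y) (nth z (w (g k) (e k)) i) < eta.
  move=> g.
  have [|y yP] := sh (fun m => nth z (w (g (m %/ L)%N) (e (m %/ L)%N)) (m %% L)%N).
    by apply: (@pseudo_orbit_of_loops _ _ _ _ _ _ (fun k => w (g k) (e k))) => // k;
      case: (wL (g k) (e k)).
  exists y => k i iL; have := yP (k * L + i)%N.
  by rewrite divnMDl// divn_small// addn0 modnMDl modn_small.
have yirr g : irregular_set T Phi (y g).
  apply: (alternating_blocks_irregular L0 b1 c0 PhiB bc) => k /=.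
  have := blk (fun k' => g (k + k')%N) (fun k' => e (k + k')%N) (iter (k * L) T (y g)).
  rewrite /= addn0 => h.
  have := h _; under eq_bigr do rewrite -iterD addnC.
  apply => k' i iL; rewrite -iterD.
  have -> : (k' * L + i + k * L = (k + k') * L + i)%N by lia.
  exact: yP.
split.
  have [g0 _] : exists g0 : G, true by have /card_gt0P[g0 _] := G0; exists g0.
  by exists (y (fun=> g0)).
apply: (htop_ge_coding G0 L0 eta_gt0 yirr) => g g' k /(wsep _ _ (e k))[i iL wi].
exists (k * L + i)%N; first by rewrite mulnS [(L * k)%N]mulnC addnC ltn_add2r.
have h1 := yP g k _ iL; have h2 := yP g' k _ iL; move: h1 h2 wi eta4.
set a := iter _ _ _; set a' := iter _ _ _; set v := nth _ _ _; set v' := nth _ _ _.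
move=> h1 h2 wi eta4.
have := metric_triangle v a v'; have := metric_triangle a a' v'.
rewrite (metric_sym v a); lra.
Qed.

End IrregularPoints.

(** * Free concatenation of loops *)

Lemma size_flatten_const (I : eqType) n (ss : seq (seq I)) :
  (forall s, s \in ss -> size s = n) -> size (flatten ss) = (size ss * n)%N.
Proof.
elim: ss => //= s ss IHss h; rewrite size_cat h ?mem_head// IHss ?mulSn// => s' ss'.
by apply: h; rewrite inE ss' orbT.
Qed.

Lemma nth_flatten_const (I : eqType) (z : I) n (ss : seq (seq I)) j k :
  (forall s, s \in ss -> size s = n) -> (j < size ss)%N -> (k < n)%N ->
  nth z (flatten ss) (j * n + k) = nth z (nth [::] ss j) k.
Proof.
elim: ss j => //= s ss IHss j h jss kn; rewrite nth_cat h ?mem_head//.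
case: j jss => [|j] jss; first by rewrite mul0n add0n kn.
rewrite mulSn -addnA ltnNge leq_addr/= addKn IHss// => s' ss'.
by apply: h; rewrite inE ss' orbT.
Qed.

Section FreeLoops.
Context {R : realType} {X : metricType R} (T : X -> X).

(** A block is a word of [q] free letters followed by a forced tail [v e], so
    the tail lowers the entropy only through its share [nv / L] of the time. *)
Lemma irregular_of_free_loops (Phi : X -> R) (B : R) (J : finType) n q nv z
    (F : J -> seq X) (v : bool -> seq X) (delta eta eta0 A c : R) :
  let L := (q * n + nv)%N in
  let w (g : q.-tuple J) e := flatten [seq F j | j <- g] ++ v e in
  (0 < L)%N -> (0 < #|J|)%N -> 0 < eta -> 4 * eta <= eta0 -> 0 < c ->
  (forall x, `|Phi x| <= B) ->
  (forall x, pseudo_orbit T delta x ->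
     exists y, forall n, mdist (iter n T y) (x n) < eta) ->
  (forall j, size (F j) = n /\ pseudo_loop T delta z (F j)) ->
  (forall e, size (v e) = nv /\ pseudo_loop T delta z (v e)) ->
  (forall i j, i != j -> exists2 k, (k < n)%N &
     eta0 <= mdist (nth z (F i) k) (nth z (F j) k)) ->
  (forall (g : nat -> q.-tuple J) (e : nat -> bool) y,
     (forall k i, (i < L)%N ->
        mdist (iter (k * L + i) T y) (nth z (w (g k) (e k)) i) < eta) ->
     let S := \sum_(0 <= i < L) Phi (iter i T y) in
     if e 0 then L%:R * (A + c) <= S else S <= L%:R * A) ->
  irregular_set T Phi !=set0 /\
  ((q%:R * ln #|J|%:R / L%:R)%:E <= htop T (irregular_set T Phi))%E.
Proof.
move=> L w L0 J0 eta_gt0 eta4 c0 PhiB sh FP vP Fsep blk.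
have FnP (g : q.-tuple J) s : s \in [seq F j | j <- g] ->
    size s = n /\ pseudo_loop T delta z s.
  by move=> /mapP[j _ ->]; exact: FP.
have sF (g : q.-tuple J) : size (flatten [seq F j | j <- g]) = (q * n)%N.
  by rewrite (@size_flatten_const _ n) ?size_map ?size_tuple// => s /FnP[].
have -> : q%:R * ln #|J|%:R = ln #|{: q.-tuple J}|%:R :> R.
  by rewrite card_tuple natrX lnXn ?ltr0n// mulr_natl.
apply: (@irregular_of_loop_blocks _ _ _ Phi B _ L z w delta eta eta0 A c) => //.
- by rewrite card_tuple expn_gt0 J0.
- move=> g e; split.
    by rewrite size_cat sF; case: (vP e) => ->.
  apply: pseudo_loop_cat; last by case: (vP e).
  by apply: pseudo_loop_flatten => s /FnP[].
- move=> g g' e gg'.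
  have [j gj] : exists j, tnth g j != tnth g' j.
    apply: contrapT => /forallNP h; apply: gg'; apply: eq_from_tnth => j.
    by apply/eqP; apply: contrapT => /negP; exact: h.
  have [k kn Fk] := Fsep _ _ gj.
  have jk : (j * n + k < q * n)%N.
    apply: (@leq_trans (j.+1 * n)%N); first by rewrite mulSnr ltn_add2l.
    by rewrite leq_mul2r ltn_ord orbT.
  exists (j * n + k)%N; first by rewrite (leq_trans jk)// leq_addr.
  rewrite /w !nth_cat !sF jk.
  have Fj (h : q.-tuple J) :
      nth z (flatten [seq F j | j <- h]) (j * n + k) = nth z (F (tnth h j)) k.
    rewrite (@nth_flatten_const _ _ n)// => [||]; last 2 first.
    - by move=> s /FnP[].
    - by rewrite size_map size_tuple.
    by rewrite (nth_map (tnth g j)) ?size_tuple// (tnth_nth (tnth g j) h).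
  by rewrite !Fj.
Qed.

(** A long orbit segment of a point of the piece closes up into a loop at the
    cost of boundedly many extra points, whose effect on the average vanishes
    with the length. *)
Lemma exists_loop_near_average (Phi : X -> R) (B delta : R) z (K l : nat)
    (cell : X -> 'I_l) (p q : 'I_l -> seq X) x :
  (forall x, `|Phi x| <= B) ->
  (forall m, (K < m)%N -> pseudo_loop T delta z
    (p (cell (iter K T x)) ++ orbit_segment T x K m ++ q (cell (iter m T x)))) ->
  forall d : R, 0 < d -> exists N, forall m, (N <= m)%N ->
  exists u, [/\ (0 < size u)%N, pseudo_loop T delta z u &
    `|(size u)%:R^-1 * \sum_(y <- u) Phi y - birkhoff_average T Phi x m| <= d].
Proof.
move=> PhiB loopx d d0.
have B0 : 0 <= B by apply: le_trans (PhiB x).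
pose C := (K + \max_i size (p i) + \max_i size (q i))%N.
exists (K + (Num.truncn (2 * C%:R * B / d)).+1)%N => m Nm.
have Km : (K < m)%N by apply: leq_trans Nm; rewrite addnS ltnS leq_addr.
exists (p (cell (iter K T x)) ++ orbit_segment T x K m ++ q (cell (iter m T x))).
set P := p _; set Q := q _.
have PC : (size P <= \max_i size (p i))%N.
  exact: (@leq_bigmax _ (fun i => size (p i))).
have QC : (size Q <= \max_i size (q i))%N.
  exact: (@leq_bigmax _ (fun i => size (q i))).
set u := P ++ _; have su : size u = (size P + (m - K) + size Q)%N.
  by rewrite /u !size_cat size_orbit_segment addnA.
have su0 : (0 < size u)%N by rewrite su; lia.
split => //; first exact: loopx.
have sumB (s : seq X) : `|\sum_(y <- s) Phi y| <= (size s)%:R * B.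
  apply: le_trans (ler_norm_sum _ _ _) _.
  apply: le_trans (ler_sum _ (fun i _ => PhiB i)) _.
  by rewrite big_const_seq count_predT iter_addr_0 mulr_natl.
have sumD : `|\sum_(y <- u) Phi y - \sum_(0 <= i < m) Phi (iter i T x)| <= C%:R * B.
  rewrite /u !big_cat/= big_map (@big_cat_nat _ _ _ K 0 m)//= ?(ltnW Km)//.
  set S := \sum_(K <= i < m) _; set SK := \sum_(0 <= i < K) _.
  have SKB : `|SK| <= K%:R * B.
    have := sumB (orbit_segment T x 0 K).
    by rewrite /orbit_segment big_map size_map size_iota subn0.
  have := sumB P; have := sumB Q; move: SKB.
  have : (size P)%:R * B + (size Q)%:R * B + K%:R * B <= C%:R * B.
    by rewrite -!mulrDl ler_wpM2r// -!natrD ler_nat /C; lia.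
  rewrite !ler_norml => h /andP[? ?] /andP[? ?] /andP[? ?].
  by apply/andP; split; lra.
have m0 : 0 < m%:R :> R by rewrite ltr0n (leq_ltn_trans _ Km).
have u0 : 0 < (size u)%:R :> R by rewrite ltr0n.
rewrite /birkhoff_average.
set U := \sum_(y <- u) _ in sumD *; set S := \sum_(0 <= i < m) _ in sumD *.
have -> : (size u)%:R^-1 * U - m%:R^-1 * S =
    m%:R^-1 * (U - S + (m%:R - (size u)%:R) * ((size u)%:R^-1 * U)).
  by field; rewrite !gt_eqF.
rewrite normrM normfV (ger0_norm (ltW m0)) ler_pdivrMl//.
have UB : `|(size u)%:R^-1 * U| <= B.
  rewrite normrM normfV (ger0_norm (ltW u0)) ler_pdivrMl//; exact: sumB.
have mu : `|m%:R - (size u)%:R| <= C%:R :> R.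
  have r1 : m%:R <= (size u)%:R + C%:R :> R by rewrite -natrD ler_nat su /C; lia.
  have r2 : (size u)%:R <= m%:R + C%:R :> R by rewrite -natrD ler_nat su /C; lia.
  by rewrite ler_norml; apply/andP; split; lra.
have : 2 * C%:R * B / d < m%:R.
  apply: lt_le_trans (truncnS_gt _) _; rewrite ler_nat.
  by apply: leq_trans Nm; exact: leq_addl.
rewrite ltr_pdivrMr// => /ltW; apply: le_trans.
apply: le_trans (ler_normD _ _) _; rewrite normrM.
have := ler_pM (normr_ge0 _) (normr_ge0 _) mu UB; lra.
Qed.

End FreeLoops.

(** * Irregular sets under perturbation of the function *)

Section CompactSpace.
Context {R : realType} {X : metricType R}.
Hypothesis X_compact : compact [set: X].

Lemma continuous_bounded (Phi : X -> R) : continuous Phi ->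
  exists B : R, forall x, `|Phi x| <= B.
Proof.
move=> cPhi; have := continuous_compact (continuous_subspaceT cPhi) X_compact.
move=> /compact_bounded[M [_ /(_ (M + 1))]]; rewrite ltrDl ltr01 => /(_ isT) MB.
by exists (M + 1) => x; apply: MB; exists x.
Qed.

Lemma uniformly_continuous (Phi : X -> R) (d : R) : continuous Phi -> 0 < d ->
  exists2 e : R, 0 < e & forall x y, mdist x y < e -> `|Phi x - Phi y| < d.
Proof.
move=> cPhi d0.
pose P (e : R) x := forall y, mdist x y < e -> `|Phi x - Phi y| < d.
have [] : \forall e \near (0 : R)^'+, [set: X] `<=` P e; last first.
  move=> e /= e0 eP; exists (e / 2); first by rewrite divr_gt0.
  move=> x; apply: (eP (e / 2)) => //=; last by rewrite divr_gt0.
  by rewrite sub0r normrN gtr0_norm ?divr_gt0// ltr_pdivrMr// ltr_pMr// ltr1n.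
move/compact_near_coveringP: X_compact; apply => x _.
have /cvgrPdist_lt/(_ (d / 2)) := cPhi x; rewrite divr_gt0// => /(_ isT).
rewrite nearE -nbhs_ballE => -[r /= r0 rx].
exists (ball x (r / 2), [set e | e < r / 2]).
  split; first by apply: nbhsx_ballx; rewrite divr_gt0.
  by apply: nbhs_right_lt; rewrite divr_gt0.
move=> [y e] /= [xy er] w yw.
have h z : mdist x z < r -> `|Phi x - Phi z| < d / 2.
  by move=> xz; apply: rx; rewrite ballEmdist.
move: xy; rewrite ballEmdist /= => xy.
have h1 : `|Phi x - Phi y| < d / 2.
  by apply: h; apply: (lt_trans xy); rewrite ltr_pdivrMr// ltr_pMr// ltr1n.
have h2 : `|Phi x - Phi w| < d / 2.
  apply: h; have := metric_triangle x y w; lra.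
move: h1 h2; rewrite !ltr_norml => /andP[? ?] /andP[? ?].
by apply/andP; split; lra.
Qed.

End CompactSpace.

Lemma not_cvgn_oscillates (R : realType) (u : nat -> R) : ~ cvgn u ->
  exists m, forall N, exists n1 n2, [/\ (N <= n1)%N, (N <= n2)%N &
    m.+1%:R^-1 < u n1 - u n2].
Proof.
move=> ncv; apply: contrapT => /forallNP h; apply: ncv.
apply/cauchy_cvgP/cauchy_ballP => _/posnumP[e]; near_simpl.
have [m _ /(_ m (leqnn m)) /= me] := near_infty_natSinv_lt e.
have /existsNP[N hN] := h m.
have H n1 n2 : (N <= n1)%N -> (N <= n2)%N -> u n1 - u n2 < e%:num.
  move=> Nn1 Nn2; apply: le_lt_trans me; rewrite leNgt; apply/negP => lt12.
  by apply: hN; exists n1, n2.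
exists ([set n | (N <= n)%N], [set n | (N <= n)%N]).
  by split; exists N.
move=> [n1 n2] /= [Nn1 Nn2]; rewrite /ball /= ltr_norml.
by have := H _ _ Nn1 Nn2; have := H _ _ Nn2 Nn1 => ? ?; apply/andP; split; lra.
Qed.

Section Stability.
Context {R : realType} {X : metricType R} (T : X -> X).
Hypothesis X_compact : compact [set: X].
Hypothesis T_shadowing : shadowing T.

(** Close orbits have close Birkhoff sums, so the sums over a block of a
    shadowing point may be read off the loop that it shadows. *)
Lemma block_sum_close (Phi Psi : X -> R) (eta om tau : R) z s y :
  (forall x x', mdist x x' < eta -> `|Phi x - Phi x'| < om) ->
  (forall x, `|Phi x - Psi x| < tau) ->
  (forall i, (i < size s)%N -> mdist (iter i T y) (nth z s i) < eta) ->
  `|\sum_(0 <= i < size s) Psi (iter i T y) - \sum_(x <- s) Phi x| <=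
  (size s)%:R * (om + tau).
Proof.
move=> Phiom PhiPsi sy; rewrite (big_nth z) -sumrB.
apply: le_trans (ler_norm_sum _ _ _) _.
rewrite mulr_natl -[X in _ *+ X]subn0 -sumr_const_nat; apply: ler_sum_nat => i /andP[_ is_].
have := PhiPsi (iter i T y); have := Phiom _ _ (sy i is_).
rewrite ler_norml !ltr_norml => /andP[? ?] /andP[? ?].
by apply/andP; split; lra.
Qed.

Lemma size_flatten_nseq k (s : seq X) : size (flatten (nseq k s)) = (k * size s)%N.
Proof. by elim: k => //= k IHk; rewrite size_cat IHk mulSn. Qed.

Lemma sum_flatten_nseq (Phi : X -> R) k s :
  \sum_(x <- flatten (nseq k s)) Phi x = k%:R * \sum_(x <- s) Phi x.
Proof.
elim: k => [|k IHk]; first by rewrite big_nil mul0r.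
by rewrite /= big_cat/= IHk -nat1r mulrDl mul1r.
Qed.

(** The irregularity and the entropy of [irregular_set T Phi] are already
    visible on loops at one scale: a large family of loops of nearly equal
    [Phi]-average, and two loops with clearly different averages. Concatenating
    them freely survives a small change of [Phi]. *)
Lemma irregular_set_stable (Phi : X -> R) (a : R) : continuous Phi ->
  (a%:E < htop T (irregular_set T Phi))%E ->
  exists2 tau : R, 0 < tau & forall Psi : X -> R,
    (forall x, `|Phi x - Psi x| < tau) ->
    irregular_set T Psi !=set0 /\ (a%:E < htop T (irregular_set T Psi))%E.
Proof.
move=> cPhi /htop_gtP[t [eta0 [at_ eta00 outerI]]].
have [B PhiB] := continuous_bounded X_compact cPhi.
have [m outerE] : exists m, bowen_outer T [set x | forall N, exists n1 n2,
    [/\ (N <= n1)%N, (N <= n2)%N & m.+1%:R^-1 <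
     birkhoff_average T Phi x n1 - birkhoff_average T Phi x n2]] t eta0 <> 0%E.
  apply: bowen_outer_bigcup_neq0 => h; apply: outerI.
  apply: bowen_outer_eq0_le h => // x /not_cvgn_oscillates[m mP].
  by exists m.
set c : R := m.+1%:R^-1 in outerE; have c0 : 0 < c by rewrite invr_gt0.
set E := (X in bowen_outer T X) in outerE.
(* Free letters producing entropy at rate [t'] will fill the fraction
   [r / (r + 1)] of the time, which must still beat [a]. *)
pose t' := (a + t) / 2.
have [at' t't] : a < t' /\ t' < t by rewrite /t' !midf_lt.
pose r := (Num.truncn (`|t'| / (t' - a))).+1.
have rP : a < r%:R * t' / (r%:R + 1).
  rewrite ltr_pdivlMr ?ltr_wpDl//.
  have : `|t'| / (t' - a) < r%:R by exact: truncnS_gt.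
  rewrite ltr_pdivrMr ?subr_gt0// => h; have := ler_norm t'; lra.
have r1 : 0 < r%:R + 1 :> R by rewrite ltr_wpDl.
(* A block has contrast [3 / 4 * c / (r + 1)] per unit of time between its two
   kinds. The free part blurs it by at most [4 * om], shadowing and perturbation
   by [2 * om] on each side, so that [8 * om] is still left of [24 * om]. *)
pose om : R := c / (32 * (r%:R + 1)).
have om0 : 0 < om by rewrite divr_gt0// mulr_gt0.
have omE : c = 32 * (r%:R + 1) * om by rewrite /om mulrC divfK// gt_eqF// mulr_gt0.
have [e1 e10 e1P] := uniformly_continuous X_compact cPhi om0.
pose eta := Num.min (eta0 / 4) e1.
have eta_gt0 : 0 < eta by rewrite lt_min e10 divr_gt0.
have eta4 : 4 * eta <= eta0.
  by rewrite mulrC -ler_pdivlMr// /eta ge_min lexx.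
have etaP x y : mdist x y < eta -> `|Phi x - Phi y| < om.
  by move=> xy; apply: e1P; apply: lt_le_trans xy _; rewrite /eta ge_min lexx orbT.
have [delta delta0 sh] := T_shadowing eta_gt0.
have [E' [K [l [cell [z [p [q [E'E outerE' loopE']]]]]]]] :=
  exists_recurrent_piece X_compact delta0 outerE.
have [x E'x] : E' !=set0.
  by apply/set0P/eqP => E'0; apply: outerE'; rewrite E'0 bowen_outer_set0.
have c8 : 0 < c / 8 by rewrite divr_gt0.
have [N0 N0P] :=
  @exists_loop_near_average R X T Phi B delta z K l cell p q x PhiB (loopE' x E'x) _ c8.
have [n1 [n2 [/N0P[u1 [u10 u1z u1a]] /N0P[u2 [u20 u2z u2a]] n12]]] := E'E _ E'x N0.
have kappa0 : 0 < c / (8 * (r%:R + 1)) by rewrite divr_gt0// mulr_gt0.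
have [n [A0 [N [F [n0 Nt Fz Favg Fsep]]]]] :=
  @exists_loop_family R X T X_compact E' t t' eta0 delta _ B Phi K l cell z p q
    eta00 t't kappa0 PhiB outerE' loopE' 1.
exists om => // Psi PhiPsi.
(* The repetition counts give both tails the length of [d] letters. *)
pose d := (size u1 * size u2)%N.
have d0 : (0 < d)%N by rewrite muln_gt0 u10.
pose v (e : bool) := if e then flatten (nseq (n * size u2) u1)
  else flatten (nseq (n * size u1) u2).
have NR : 0 < N%:R :> R by apply: lt_le_trans Nt; exact: expR_gt0.
have N_gt0 : (0 < N)%N by rewrite -(ltr_nat R).
have fnq (s : seq X) k w : w \in nseq k s -> w = s by move=> /nseqP[].
have sv e : size (v e) = (n * d)%N.
  by case: e; rewrite /v size_flatten_nseq /d -mulnA// [(size u2 * _)%N]mulnC.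
pose q' := (d * r)%N.
pose L := (q' * n + n * d)%N.
have LE : L = (n * d * r.+1)%N by rewrite /L /q' mulnS addnC [(d * r * n)%N]mulnC mulnA.
have L0 : (0 < L)%N by rewrite LE !muln_gt0 n0 u10 u20.
pose a1 := (size u1)%:R^-1 * \sum_(y <- u1) Phi y.
pose a2 := (size u2)%:R^-1 * \sum_(y <- u2) Phi y.
have a12 : a2 + c * (3 / 4) <= a1.
  move: u1a u2a n12; rewrite !ler_norml -/a1 -/a2 => /andP[? ?] /andP[? ?] ?; lra.
pose A := (r%:R * (A0 + c / (8 * (r%:R + 1))) + a2) / (r%:R + 1) + 2 * om.
pose c' := 8 * om.
have [I1 I2] : irregular_set T Psi !=set0 /\
    ((q'%:R * ln #|'I_N|%:R / L%:R)%:E <= htop T (irregular_set T Psi))%E.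
  apply: (@irregular_of_free_loops _ _ T Psi (B + om) 'I_N n q' (n * d)%N z F v
    delta eta eta0 A c') => //.
  - by rewrite card_ord.
  - by rewrite mulr_gt0.
  - move=> w; have := PhiPsi w; have := PhiB w; rewrite !ler_norml ltr_norml.
    by move=> /andP[? ?] /andP[? ?]; apply/andP; split; lra.
  - move=> e; split; first exact: sv.
    by case: e; apply: pseudo_loop_flatten => w /fnq ->.
  move=> g e y yP; set S := \sum_(0 <= i < _) _.
  set W := flatten [seq F j | j <- g 0] ++ v (e 0).
  have sW : size W = L.
    rewrite size_cat sv (@size_flatten_const _ n) ?size_map ?size_tuple//.
    by move=> w /mapP[j _ ->]; case: (Fz j).
  have := @block_sum_close Phi Psi eta om om z W y etaP PhiPsi.
  rewrite sW -/S => /(_ _)/wrap[i iL|]; first by have := yP 0 i iL; rewrite mul0n add0n.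
  have -> : \sum_(w <- W) Phi w =
      \sum_(j <- g 0) \sum_(w <- F j) Phi w + \sum_(w <- v (e 0)) Phi w.
    by rewrite big_cat/= big_flatten/= big_map.
  have Sv : \sum_(w <- v (e 0)) Phi w = (n * d)%:R * (if e 0 then a1 else a2).
    have u1R : (size u1)%:R != 0 :> R by rewrite pnatr_eq0 -lt0n.
    have u2R : (size u2)%:R != 0 :> R by rewrite pnatr_eq0 -lt0n.
    by case: (e 0); rewrite /v sum_flatten_nseq /a1 /a2 /d !natrM; field.
  set SF := \sum_(j <- g 0) _.
  have [SF1 SF2] : q'%:R * (A0 * n%:R) <= SF /\
      SF <= q'%:R * ((A0 + c / (8 * (r%:R + 1))) * n%:R).
    have cst (b : R) : q'%:R * b = \sum_(j <- g 0) b.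
      by rewrite big_const_seq count_predT iter_addr_0 size_tuple mulr_natl.
    by rewrite !cst; split; apply: ler_sum => j _; case/andP: (Favg j).
  have qnE : q'%:R * n%:R = r%:R * (n * d)%:R :> R.
    by rewrite -!natrM /q' [(d * r * n)%N]mulnC mulnA mulnC.
  have LR : L%:R = (n * d)%:R * (r%:R + 1) :> R by rewrite LE natrM natr1.
  rewrite Sv ler_norml LR => /andP[S1 S2].
  have nd0 : 0 < (n * d)%:R :> R by rewrite ltr0n muln_gt0 n0.
  have kE : c / (8 * (r%:R + 1)) = 4 * om.
    by rewrite omE; field; rewrite gt_eqF.
  have AE : (r%:R + 1) * A = r%:R * (A0 + 4 * om) + a2 + 2 * om * (r%:R + 1).
    by rewrite /A kE; field; rewrite gt_eqF.
  rewrite kE in SF2.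
  have qnb (b : R) : q'%:R * (b * n%:R) = (n * d)%:R * (r%:R * b).
    by rewrite mulrCA qnE; ring.
  rewrite !qnb in SF1 SF2.
  move: (n * d)%:R nd0 S1 S2 SF1 SF2 => ND nd0 S1 S2 SF1 SF2.
  have AL : ND * (r%:R + 1) * A =
      ND * (r%:R * (A0 + 4 * om) + a2 + 2 * om * (r%:R + 1)) by rewrite -mulrA AE.
  case: (e 0) S1 S2 => /= S1 S2; last by rewrite AL; lra.
  have h : ND * (r%:R * (4 * om) + a2 + 12 * (om * (r%:R + 1))) <= ND * a1.
    by rewrite ler_pM2l//; move: a12; rewrite omE; lra.
  by rewrite mulrDr AL /c'; lra.
split => //; apply: lt_le_trans I2; rewrite lte_fin.
apply: (lt_le_trans rP); rewrite card_ord LE ler_pdivrMr// mulrAC ler_pdivlMr; last first.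
  by rewrite ltr0n -LE.
rewrite /q' !natrM -natr1.
have lnN : t' * n%:R <= ln N%:R by rewrite -ler_expR lnK.
have dr0 : 0 <= (size u1)%:R * (size u2)%:R * r%:R * (r%:R + 1) :> R.
  by rewrite !mulr_ge0// ltW.
by have := ler_wpM2l dr0 lnN; lra.
Qed.

End Stability.

(** * A function with a large irregular set *)

Lemma continuous_mdist (R : realType) (X : metricType R) (q : X) :
  continuous (fun x : X => mdist x q).
Proof.
move=> x; apply/cvgrPdist_lt => e e0.
apply/nbhs_ballP; exists e => //= y; rewrite ballEmdist /= => xy.
have := metric_triangle x y q; have := metric_triangle y x q.
rewrite (metric_sym y x) => ? ?.
by rewrite ltr_norml; apply/andP; split; lra.
Qed.

Lemma continuous_iter (X : topologicalType) (T : X -> X) n :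
  continuous T -> continuous (iter n T).
Proof.
move=> cT; elim: n => [|n IHn] x; first exact: cvg_id.
exact: continuous_comp (IHn x) (cT _).
Qed.

Lemma continuous_prod (R : realType) (X : topologicalType) (f : nat -> X -> R) n :
  (forall m, continuous (f m)) -> continuous (fun x => \prod_(m < n) f m x).
Proof.
move=> cf; elim: n => [|n IHn] x.
  by under eq_fun do rewrite big_ord0; exact: cvg_cst.
under eq_fun do rewrite big_ord_recr/=.
by apply: cvgM; [exact: IHn|exact: cf].
Qed.

(** Losing [n] of the letters that an exponent [s + u] provides leaves as many as
    the exponent [s] does. *)
Lemma expR_ge_addn (R : realType) (s u : R) n : 0 <= s -> 0 < u ->
  4 <= u ^+ 2 * n%:R -> expR (s * n%:R) + n%:R <= expR ((s + u) * n%:R).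
Proof.
move=> s0 u0 un; rewrite mulrDl expRD.
have e1 : 1 <= expR (s * n%:R) by rewrite -expR0 ler_expR mulr_ge0.
have e2 : 1 + n%:R <= expR (u * n%:R).
  have -> : u * n%:R = u * n%:R / 2 + u * n%:R / 2 by lra.
  set x := _ / 2; rewrite expRD.
  have x0 : 0 <= x by rewrite divr_ge0// mulr_ge0// ltW.
  have h : 1 + x <= expR x by exact: expR_ge1Dx.
  have h0 : 0 <= 1 + x by lra.
  apply: le_trans (ler_pM h0 h0 h h).
  have -> : (1 + x) * (1 + x) = 1 + 2 * x + u ^+ 2 * n%:R * n%:R / 4.
    by rewrite /x; field.
  have : 4 * n%:R <= u ^+ 2 * n%:R * n%:R by rewrite ler_wpM2r.
  lra.
have := ler_wpM2l (expR_ge0 (s * n%:R)) e2.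
have : 1 * n%:R <= expR (s * n%:R) * n%:R by rewrite ler_wpM2r.
lra.
Qed.

Lemma exists_next_multiple i n : (0 < n)%N ->
  exists b, (i <= b * n < i + n)%N.
Proof.
move=> n0; exists ((i + n.-1) %/ n)%N.
have := leq_divM (i + n.-1) n; have := ltn_ceil (i + n.-1) n0; lia.
Qed.

Section Existence.
Context {R : realType} {X : metricType R} (T : X -> X).
Hypothesis X_compact : compact [set: X].
Hypothesis T_continuous : continuous T.
Hypothesis T_shadowing : shadowing T.

(** Each of the [n] first windows of length [n] in [p] is close to at most one
    of the pairwise separated words [F j]. *)
Lemma card_avoiding_words (eps : R) z n N (F : 'I_N -> seq X) (p : seq X) :
  (forall i j, i != j -> exists2 k, (k < n)%N &
     eps <= mdist (nth z (F i) k) (nth z (F j) k)) ->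
  (N <= #|[pred j | [forall s : 'I_n, exists i : 'I_n,
     (eps / 2 <= mdist (nth z (F j) i) (nth z p (s + i)))%R]]| + n)%N.
Proof.
move=> Fsep; set good := [pred j | _].
have /choice[f fP] : forall j, exists s : option 'I_n, j \notin good ->
    exists2 s', s = Some s' & forall i : 'I_n,
      mdist (nth z (F j) i) (nth z p (s' + i)) < eps / 2.
  move=> j; case: (boolP (j \in good)) => jg; first by exists None.
  move: jg; rewrite inE /= negb_forall => /existsP[s]; rewrite negb_exists => /forallP h.
  by exists (Some s) => _; exists s => // i; rewrite ltNge.
have finj : {in [predC good] &, injective f}.
  move=> i j /fP[s -> si] /fP[s' -> sj] [ss']; rewrite -ss' in sj.
  apply/eqP; apply: contrapT => /negP/Fsep[k kn]; apply/negP; rewrite -ltNge.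
  have := si (Ordinal kn); have := sj (Ordinal kn) => /=.
  set a := nth z (F i) k; set b := nth z (F j) k; set w := nth z p _ => h1 h2.
  by have := metric_triangle a w b; rewrite (metric_sym w b); lra.
rewrite -[X in (X <= _)%N]card_ord -(cardC good) leq_add2l.
rewrite -(card_in_imset finj) -[X in (_ <= X)%N]card_ord.
have : f @: [predC good] \subset [set Some s | s : 'I_n].
  apply/fintype.subsetP => _ /imsetP[j /fP[s -> _] ->]; apply/imsetP; by exists s.
move/subset_leq_card; rewrite (card_imset _ Some_inj); exact.
Qed.

(** The marker is the loop [p] run twice, and a letter is good if it resembles
    none of the windows of [p p]. A stretch of length [2 n] of a concatenation of
    good letters contains one of them in full, hence differs from the marker.
    The function [psi] is positive on the points whose orbit stays close for
    [2 n] steps to that of a point [q0] shadowing [p p p ...]; it vanishes on all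
    blocks without the marker, and it is at least [eta ^ (2 n)] once in each
    block with the marker. *)
Lemma exists_irregular_function (a : R) : (0 < htop T [set: X])%E ->
  (a%:E < htop T [set: X])%E ->
  exists2 psi : X -> R, continuous psi &
    irregular_set T psi !=set0 /\ (a%:E < htop T (irregular_set T psi))%E.
Proof.
move=> hT0 hTa.
have : ((Num.max a 0)%:E < htop T [set: X])%E.
  by rewrite /Num.max; case: ifP.
move=> /htop_gtP[t [eta0 [at_ eta00 outerX]]].
have a0 : 0 <= Num.max a 0 by rewrite le_max lexx orbT.
have : a <= Num.max a 0 by rewrite le_max lexx.
move: (Num.max a 0) a0 at_ => a' a0 at_ aa'.
pose t' := (a' + t) / 2; pose t'' := (a' + t') / 2.
have [at' t't] : a' < t' /\ t' < t by rewrite /t' !midf_lt.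
have [at'' t''t'] : a' < t'' /\ t'' < t' by rewrite /t'' !midf_lt.
pose r := (Num.truncn (2 * a' / (t'' - a'))).+1.
have rP : a' < r%:R * t'' / (r%:R + 2).
  rewrite ltr_pdivlMr ?ltr_wpDl//.
  have : 2 * a' / (t'' - a') < r%:R by exact: truncnS_gt.
  rewrite ltr_pdivrMr ?subr_gt0//; lra.
(* A letter differs from the marker by [eta0 / 2]; after the two shadowing
   errors there must remain [3 * eta], the threshold in [psi]. *)
pose eta := eta0 / 10.
have eta_gt0 : 0 < eta by rewrite divr_gt0.
have etaE : eta0 = 10 * eta by rewrite /eta; lra.
have [delta delta0 sh] := T_shadowing eta_gt0.
have [E' [K [l [cell [z [p0 [q [_ outerE' loopE']]]]]]]] :=
  exists_recurrent_piece X_compact delta0 outerX.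
have Phi0B : forall x : X, `|(fun=> 0 : R) x| <= 0 by move=> x; rewrite normr0.
have [n [_ [N [F [n1 Nt Fz _ Fsep]]]]] :=
  @exists_loop_family R X T X_compact E' t t' eta0 delta 1 0 (fun=> 0) K l cell z
    p0 q eta00 t't ltr01 Phi0B outerE' loopE'
    (Num.truncn (4 / (t' - t'') ^+ 2)).+1.
have {Phi0B} n0 : (0 < n)%N by apply: leq_trans n1.
have nR : 0 < n%:R :> R by rewrite ltr0n.
have NR : 0 < N%:R :> R by apply: lt_le_trans Nt; exact: expR_gt0.
have N_gt0 : (0 < N)%N by rewrite -(ltr_nat R).
pose p := F (Ordinal N_gt0); pose pp := p ++ p.
have sp : size p = n by case: (Fz (Ordinal N_gt0)).
have pz : pseudo_loop T delta z p by case: (Fz (Ordinal N_gt0)).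
have spp : size pp = (2 * n)%N by rewrite size_cat sp mul2n addnn.
have := @card_avoiding_words eta0 z n N F pp Fsep.
set good := [pred j | _] => Ngood.
pose J : finType := {j : 'I_N | good j}.
have Jt : expR (t'' * n%:R) <= #|J|%:R.
  have tt0 : 0 < t' - t'' by rewrite subr_gt0.
  have h : 4 <= (t' - t'') ^+ 2 * n%:R.
    rewrite mulrC -ler_pdivrMr ?exprn_gt0//; apply/ltW.
    by apply: lt_le_trans (truncnS_gt _) _; rewrite ler_nat.
  have t''0 : 0 <= t'' by apply: ltW; apply: le_lt_trans at''.
  rewrite -(lerD2r n%:R); apply: le_trans (expR_ge_addn t''0 tt0 h) _.
  rewrite addrC subrK; apply: le_trans Nt _.
  by rewrite -natrD ler_nat card_sig.
have J0 : (0 < #|J|)%N by rewrite -(ltr_nat R) (lt_le_trans _ Jt) ?expR_gt0.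
have [j0 _] : exists j0 : J, true by have /card_gt0P[j0 _] := J0; exists j0.
pose FJ (j : J) := F (val j).
have [q0 q0P] : exists q0, forall m, (m < 2 * n)%N ->
    mdist (iter m T q0) (nth z pp m) < eta.
  have [|q0 q0P] := sh (fun m => nth z p (m %% n)%N).
    exact: (@pseudo_orbit_of_loops _ _ _ _ _ _ (fun=> p)).
  exists q0 => m mn; have := q0P m; rewrite /pp nth_cat sp.
  have [mn'|nm] := ltnP m n; first by rewrite modn_small.
  by have -> : (m %% n)%N = (m - n)%N by
    rewrite -{1}(subnK nm) modnDr modn_small// ltn_subLR// addnn -mul2n.
pose psi x := \prod_(m < 2 * n) Num.max 0 (3 * eta - mdist (iter m T x) (iter m T q0)).
have cpsi : continuous psi.
  apply: (@continuous_prod _ _ (fun m x =>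
    Num.max 0 (3 * eta - mdist (iter m T x) (iter m T q0)))) => m x.
  apply: (@continuous_max _ _ (fun=> 0)
    (fun x => 3 * eta - mdist (iter m T x) (iter m T q0))); first exact: cvg_cst.
  apply: cvgB; first exact: cvg_cst.
  exact: (continuous_comp (@continuous_iter _ T m T_continuous x)
    (@continuous_mdist R X (iter m T q0) _)).
exists psi; first exact: cpsi.
have [B psiB] := continuous_bounded X_compact cpsi.
have psi0 x : 0 <= psi x by apply: prodr_ge0 => m _; rewrite le_max lexx.
pose v (e : bool) := flatten (if e then [:: p; p] else [:: FJ j0; FJ j0]).
pose L := (r * n + 2 * n)%N.
have L0 : (0 < L)%N by rewrite addn_gt0 !muln_gt0 n0.
pose c := eta ^+ (2 * n) / L%:R.
have [I1 I2] : irregular_set T psi !=set0 /\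
    ((r%:R * ln #|J|%:R / L%:R)%:E <= htop T (irregular_set T psi))%E.
  apply: (@irregular_of_free_loops _ _ T psi B J n r (2 * n)%N z FJ v
    delta eta eta0 0 c) => //.
  - by rewrite etaE; lra.
  - by rewrite divr_gt0 ?exprn_gt0// ltr0n.
  - by move=> j; exact: Fz.
  - move=> e; split.
      by rewrite /v (@size_flatten_const _ n); case: e => //= s;
        rewrite !inE => /orP[] /eqP -> //; case: (Fz (val j0)).
    by apply: pseudo_loop_flatten => s; case: e; rewrite !inE => /orP[] /eqP -> //;
      case: (Fz (val j0)).
  - by move=> i j ij; apply: Fsep; rewrite val_eqE.
  move=> g e y yP; set S := \sum_(0 <= i < _) _.
  have sFJ (h : r.-tuple J) s : s \in [seq FJ j | j <- h] -> size s = n.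
    by move=> /mapP[j _ ->]; case: (Fz (val j)).
  case e0 : (e 0).
    have LR : L%:R != 0 :> R by rewrite pnatr_eq0 -lt0n.
    rewrite add0r /c mulrC divfK//.
    have rL : (r * n < L)%N by rewrite -[X in (X < _)%N]addn0 ltn_add2l muln_gt0.
    apply: (@le_trans _ _ (psi (iter (r * n) T y))); last first.
      rewrite /S (bigD1_seq (r * n)%N) ?mem_index_iota ?iota_uniq//=.
      by rewrite lerDl sumr_ge0.
    rewrite -[(2 * n)%N in leLHS]card_ord -prodr_const.
    apply: ler_prod => m _; rewrite (ltW eta_gt0) le_max; apply/orP; right.
    have := q0P m (ltn_ord m); have := yP 0 (r * n + m)%N.
    rewrite ltn_add2l ltn_ord => /(_ isT).
    rewrite e0 mul0n add0n nth_cat (@size_flatten_const _ n) ?size_map ?size_tuple;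
      last exact: sFJ.
    rewrite ltnNge leq_addr/= addKn /v /= cats0 -/pp addnC -iterD.
    set a1 := iter _ T y; set a2 := nth _ _ _; set a3 := iter _ _ _ => h1 h2.
    by have := metric_triangle a1 a2 a3; rewrite (metric_sym a2 a3); lra.
  (* The first letter to start at or after time [i] has rank [b]; it may be the
     first one of the next block. *)
  rewrite mulr0 /S big_nat_cond big1// => i; rewrite andbT => /andP[_ iL].
  have [b /andP[ib bi]] := exists_next_multiple i n0.
  have br : (b <= r.+2)%N.
    rewrite -ltnS -(ltn_pmul2r n0) (leq_trans bi)// mulSnr leq_add2r.
    by move: iL; rewrite /L -mulnDl addn2 => /ltnW.
  have [j jP] : exists j : J, forall m, (m < n)%N ->
      mdist (iter (b * n + m) T y) (nth z (FJ j) m) < eta.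
    move: br; rewrite leq_eqVlt => /orP[/eqP ->|br].
      exists (nth j0 (g 1) 0) => m mn.
      have mL : (m < L)%N.
        by apply: leq_trans mn _; rewrite /L -mulnDl addn2 leq_pmull.
      have := yP 1 m mL; rewrite mul1n nth_cat.
      rewrite (@size_flatten_const _ n) ?size_map ?size_tuple; last exact: sFJ.
      have -> : (m < r * n)%N by apply: leq_trans mn _; rewrite leq_pmull.
      have := @nth_flatten_const _ z n [seq FJ j | j <- g 1] 0 m (sFJ (g 1)).
      rewrite size_map size_tuple mul0n add0n => -> //.
      by rewrite (nth_map j0) ?size_tuple// /L -mulnDl addn2.
    exists (nth j0 (g 0 ++ [:: j0; j0]) b) => m mn.
    have bmL : (b * n + m < L)%N.
      rewrite /L -mulnDl addn2; apply: (@leq_trans (b.+1 * n)%N).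
        by rewrite mulSnr ltn_add2l.
      by rewrite leq_mul2r br orbT.
    have := yP 0 _ bmL; rewrite mul0n add0n e0 /v -flatten_cat.
    have -> : [seq FJ j | j <- g 0] ++ [:: FJ j0; FJ j0] =
        [seq FJ j | j <- g 0 ++ [:: j0; j0]] by rewrite map_cat.
    have sg : size (g 0 ++ [:: j0; j0]) = r.+2 by rewrite size_cat size_tuple addn2.
    rewrite (@nth_flatten_const _ _ n) ?size_map ?sg//.
      by rewrite (nth_map j0) ?sg.
    by move=> s /mapP[j _ ->]; case: (Fz (val j)).
  have sn : (b * n - i < n)%N by rewrite ltn_subLR.
  have /forallP/(_ (Ordinal sn))/existsP[[m mn] /= jm] := valP j.
  have m2n : (b * n - i + m < 2 * n)%N by rewrite mul2n -addnn -addSn leq_add// ltnW.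
  apply/eqP/prodf_eq0; exists (Ordinal m2n) => //=.
  apply/eqP; apply/max_idPl.
  have := q0P _ m2n; have := jP _ mn.
  rewrite -iterD addnAC subnK//.
  move: jm; rewrite /FJ.
  set a1 := iter _ T y; set a2 := nth _ _ _; set a3 := iter _ _ _.
  set a4 := nth _ _ _ => h1 h2 h3.
  have := metric_triangle a2 a1 a4; have := metric_triangle a1 a3 a4.
  by rewrite (metric_sym a2 a1); lra.
split; first exact: I1.
apply: lt_le_trans I2; rewrite lte_fin.
apply: (le_lt_trans aa'); apply: (lt_le_trans rP).
have -> : L%:R = (r%:R + 2) * n%:R :> R by rewrite /L natrD !natrM; ring.
rewrite ler_pdivrMr ?ltr_wpDl//.
have lnN : t'' * n%:R <= ln #|J|%:R by rewrite -ler_expR lnK// posrE ltr0n.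
have -> : r%:R * ln #|J|%:R / ((r%:R + 2) * n%:R) * (r%:R + 2) =
    r%:R * (ln #|J|%:R / n%:R) :> R.
  by field; rewrite !gt_eqF// ltr_wpDl.
by rewrite ler_wpM2l// ler_pdivlMr.
Qed.

End Existence.

(** * The space of continuous functions *)

Section FunctionSpace.
Context {R : realType} {X : metricType R}.
Hypothesis X_compact : compact [set: X].
Implicit Types (f g : C0 X) (U : set (C0 X)).

Definition to_C0 (f : X -> R) (cf : continuous f) : C0 X :=
  (mkcts cf : continuousType X R).

Lemma C0_fun_to_C0 (f : X -> R) (cf : continuous f) : C0_fun (to_C0 cf) = f.
Proof. by []. Qed.

Lemma C0_continuous f : continuous (C0_fun f).
Proof. exact: (@cts_fun _ _ (f : continuousType X R)). Qed.

Lemma nbhs_C0_unif f U : nbhs f U <-> exists2 e : R, 0 < e & forall g,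
  (forall x, `|C0_fun f x - C0_fun g x| < e) -> U g.
Proof.
rewrite nbhs_C0_sup//; split=> -[e e0 eU].
  exists (e / 2); first by rewrite divr_gt0.
  move=> g fg; apply: eU.
  apply: (@le_lt_trans _ _ (e / 2)).
    have [->|/set0P S0] := eqVneq [set `|C0_fun f x - C0_fun g x| | x in [set: X]] set0.
      by rewrite sup0 divr_ge0// ltW.
    by apply: ge_sup S0 _ => _ [x _ <-]; exact/ltW.
  by rewrite ltr_pdivrMr// ltr_pMr// ltr1n.
exists e => // g fg; apply: eU => x; apply: le_lt_trans fg.
apply: ub_le_sup; last by exists x.
have [Bf BfP] := continuous_bounded X_compact (@C0_continuous f).
have [Bg BgP] := continuous_bounded X_compact (@C0_continuous g).
exists (Bf + Bg) => _ [w _ <-].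
exact: le_trans (ler_normB _ _) (lerD (BfP w) (BgP w)).
Qed.

(** Baire's argument in the sup metric: balls of radii decreasing at least
    geometrically, the [k]-th one inside [U k], shrink to a uniform limit. *)
Lemma C0_baire (U : nat -> set (C0 X)) :
  (forall k, open (U k)) -> (forall k, dense (U k)) -> dense (\bigcap_k U k).
Proof.
move=> oU dU O [f0 Of0] oO.
have /nbhs_C0_unif[e0 e00 e0O] : nbhs f0 O by exact: open_nbhs_nbhs.
have /choice[step stepP] : forall p : nat * (C0 X * R), exists fe : C0 X * R,
    0 < p.2.2 -> [/\ 0 < fe.2, fe.2 <= p.2.2 / 2,
      forall x, `|C0_fun p.2.1 x - C0_fun fe.1 x| < p.2.2 / 4 &
      forall g, (forall x, `|C0_fun fe.1 x - C0_fun g x| < fe.2) -> U p.1 g].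
  move=> [k [f e]] /=; have [e_gt0|] := pselect (0 < e); last by exists (f, e).
  pose V : set (C0 X) := [set g | forall x, `|C0_fun f x - C0_fun g x| < e / 4].
  have nV : nbhs f V by apply/nbhs_C0_unif; exists (e / 4) => //; rewrite divr_gt0.
  have [g [/interior_subset Vg Ug]] : V^° `&` U k !=set0.
    by apply: dU; [exists f; exact: nV|exact: open_interior].
  have /nbhs_C0_unif[d d0 dU'] : nbhs g (U k) by apply: open_nbhs_nbhs.
  exists (g, Num.min d (e / 2)) => _ /=; split=> //.
  - by rewrite lt_min d0 divr_gt0.
  - by rewrite ge_min lexx orbT.
  - by move=> h gh; apply: dU' => x; apply: lt_le_trans (gh x) _; rewrite ge_min lexx.
pose s := fix s k := if k is k'.+1 then step (k', s k') else (f0, e0).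
have s0 k : 0 < (s k).2.
  by elim: k => //= k IHk; case: (stepP (k, s k) IHk).
have s_half k : (s k.+1).2 <= (s k).2 / 2 by case: (stepP (k, s k) (s0 k)).
have s_close k x : `|C0_fun (s k).1 x - C0_fun (s k.+1).1 x| < (s k).2 / 4.
  by case: (stepP (k, s k) (s0 k)).
have s_in k g : (forall x, `|C0_fun (s k.+1).1 x - C0_fun g x| < (s k.+1).2) -> U k g.
  by case: (stepP (k, s k) (s0 k)) => _ _ _; apply.
have s_cauchy m k x : `|C0_fun (s k).1 x - C0_fun (s (k + m)%N).1 x| <= (s k).2 / 2.
  elim: m k => [|m IHm] k.
    by rewrite addn0 subrr normr0 divr_ge0// ltW.
  rewrite addnS -addSn.
  have := IHm k.+1; have := s_close k x; have := s_half k.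
  rewrite ltr_norml !ler_norml => ? /andP[? ?] /andP[? ?].
  by apply/andP; split; lra.
have s_small e : 0 < e -> exists k, (s k).2 < e.
  move=> e_gt0.
  have sk k : (s k).2 * k.+1%:R <= e0.
    elim: k => [|k IHk]; first by rewrite mulr1.
    apply: le_trans IHk.
    have k2 : k.+2%:R <= 2 * k.+1%:R :> R by rewrite -natrM ler_nat; lia.
    apply: le_trans (ler_pM (ltW (s0 k.+1)) (ler0n _ _) (s_half k) k2) _.
    by rewrite mulrA divfK.
  exists (Num.truncn (e0 / e)); have := sk (Num.truncn (e0 / e)).
  rewrite -ler_pdivlMr ?ltr0n// => /le_lt_trans; apply.
  rewrite ltr_pdivrMr ?ltr0n// mulrC -ltr_pdivrMr//; exact: truncnS_gt.
have lims x : exists l : R, forall k, `|C0_fun (s k).1 x - l| <= (s k).2 / 2.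
  have cs : cvgn (fun k => C0_fun (s k).1 x).
    apply/cauchy_cvgP/cauchy_ballP => _/posnumP[e]; near_simpl.
    have [k ke] := s_small e%:num ltac:(by []).
    exists ([set n | (k <= n)%N], [set n | (k <= n)%N]); first by split; exists k.
    move=> [n1 n2] /= [kn1 kn2]; rewrite /ball /=.
    have := s_cauchy (n1 - k)%N k x; have := s_cauchy (n2 - k)%N k x.
    rewrite !subnKC// ltr_norml !ler_norml => /andP[? ?] /andP[? ?].
    by apply/andP; split; lra.
  exists (lim (C0_fun (s k).1 x @[k --> \oo])) => k.
  apply/ler_addgt0Pr => e e_gt0.
  have /cvgrPdist_lt/(_ _ e_gt0)[N _ /(_ (k + N)%N (leq_addl _ _)) /= NP] := cs.
  have := s_cauchy N k x; move: NP; rewrite ltr_norml !ler_norml.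
  by move=> /andP[? ?] /andP[? ?]; apply/andP; split; lra.
have /choice[g gP] := lims.
have cg : continuous g.
  move=> x; apply/cvgrPdist_lt => e e_gt0.
  have [k ke] := s_small (e / 2) ltac:(by rewrite divr_gt0).
  have /cvgrPdist_lt/(_ (e / 2)) := @C0_continuous (s k).1 x.
  rewrite divr_gt0// => /(_ isT); apply: filterS => y fxy.
  have := gP x k; have := gP y k; move: fxy.
  rewrite !ltr_norml !ler_norml => /andP[? ?] /andP[? ?] /andP[? ?].
  by apply/andP; split; lra.
have gin k x : `|C0_fun (s k).1 x - C0_fun (to_C0 cg) x| < (s k).2.
  by apply: le_lt_trans (gP x k) _; rewrite ltr_pdivrMr// ltr_pMr// ltr1n.
exists (to_C0 cg); split; first by apply: e0O; exact: (gin 0).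
by move=> k _; apply: (s_in k); exact: gin.
Qed.

End FunctionSpace.

(** * Genericity of large irregular sets *)

Section IrregularSets.
Context {R : realType} {X : metricType R} (T : X -> X).
Implicit Types (Phi psi : X -> R) (a : R).

Lemma htop_gt_neq0 (E : set X) a : (a%:E < htop T E)%E -> E !=set0.
Proof.
move=> /htop_gtP[t [e [_ _ outerE]]]; apply/set0P/eqP => E0; apply: outerE.
by rewrite E0 bowen_outer_set0.
Qed.

(** [psi] is a linear combination of [Phi] and [Phi + s psi], so its averages
    converge wherever theirs do. *)
Lemma irregular_set_add Phi psi (s : R) : s != 0 ->
  irregular_set T psi `<=`
  irregular_set T Phi `|` irregular_set T (fun x => Phi x + s * psi x).
Proof.
move=> s0 x irr; apply: contrapT => /not_orP[/contrapT cPhi /contrapT cPs]; apply: irr.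
have -> : birkhoff_average T psi x = (fun n => s^-1 *
    (birkhoff_average T (fun x => Phi x + s * psi x) x n - birkhoff_average T Phi x n)).
  apply/funext => n; rewrite /birkhoff_average -mulrBr -sumrB.
  under [in RHS]eq_bigr do rewrite addrAC subrr add0r.
  by rewrite -mulr_sumr [RHS]mulrCA mulKf.
apply: is_cvgMr; exact: is_cvgB.
Qed.

Lemma below_real (h : \bar R) (eps : R) : 0 < eps -> (0 < h)%E ->
  exists2 a : R, below h eps = a%:E & (a%:E < h)%E.
Proof.
move=> eps0; rewrite /below; case: h => [r||] // _.
  by exists (r - eps); rewrite ?lte_fin ?ltrBlDr ?ltrDl.
by exists eps^-1; rewrite ?eqxx ?ltry.
Qed.

(** For [h = +oo] the bounds [below h (1 / (k + 1))] are the integers [k + 1]. *)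
Lemma le_of_below (h h' : \bar R) : (0 < h)%E ->
  (forall k, below h k.+1%:R^-1 < h')%E -> (h <= h')%E.
Proof.
case: h => [r||] // _; rewrite /below /=.
  case: h' => [r'||] // H; last 2 first.
  - by rewrite leey.
  - by have := H 0%N.
  rewrite lee_fin; apply/ler_addgt0Pr => e e0.
  have [k _ /(_ k (leqnn k)) /= ke] := near_infty_natSinv_lt (PosNum e0).
  have {}ke : k.+1%:R^-1 < e by exact: ke.
  have := H k; rewrite -EFinB lte_fin ltrBlDr => /ltW/le_trans; apply.
  by rewrite lerD2l ltW.
case: h' => [r'||] // H; last by have := H 0%N.
have := H (Num.truncn r'); rewrite invrK lte_fin.
by rewrite ltNge (ltW (truncnS_gt _)).
Qed.

End IrregularSets.

Unset Implicit Arguments.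

Theorem theorem3p4 (R : realType) (X : metricType R) (T : X -> X)
    (X_compact : compact [set: X]) (T_continuous : continuous T)
    (T_shadowing : shadowing T) (htop_gt0 : (0 < htop T [set: X])%E) :
  (dense (irregular_full T) /\ Gdelta (irregular_full T)) /\
  (forall eps : R, 0 < eps ->
     open (irregular_above T eps) /\ dense (irregular_above T eps)).
Proof.
have aboveP (eps : R) : 0 < eps -> exists2 a : R, (a%:E < htop T [set: X])%E &
    irregular_above T eps = [set Phi | (a%:E < htop T (irregular_set T (C0_fun Phi)))%E].
  move=> /below_real/(_ htop_gt0)[a ha ah]; exists a => //.
  apply/seteqP; split=> Phi; rewrite /irregular_above /= ha; first by case.
  by move=> aPhi; split=> //; exact: htop_gt_neq0 aPhi.
have od (eps : R) : 0 < eps -> open (irregular_above T eps) /\ dense (irregular_above T eps).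
  move=> /aboveP[a ah ->]; split.
    rewrite openE => Phi /= aPhi.
    have [tau tau0 tauP] := irregular_set_stable X_compact T_shadowing
      (@C0_continuous _ _ Phi) aPhi.
    apply/(nbhs_C0_unif X_compact); exists tau; first exact: tau0.
    by move=> Psi /tauP[_]; exact.
  have [psi cpsi [_ apsi]] :=
    exists_irregular_function X_compact T_continuous T_shadowing htop_gt0 ah.
  move=> O [Phi OPhi] oO.
  have /(nbhs_C0_unif X_compact)[e e0 eO] : nbhs Phi O by exact: open_nbhs_nbhs.
  have [B psiB] := continuous_bounded X_compact cpsi.
  pose s := e / (`|B| + 1).
  have B1 : 0 < `|B| + 1 by rewrite ltr_wpDl.
  have s0 : 0 < s by rewrite divr_gt0.
  have cs : continuous (fun x => C0_fun Phi x + s * psi x).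
    move=> x; apply: cvgD; first exact: C0_continuous.
    by apply: cvgMr; exact: cpsi.
  have := lt_le_trans apsi (le_htop T
    (@irregular_set_add _ _ T (C0_fun Phi) psi s (lt0r_neq0 s0))).
  move=> /htop_setU_gt[aPhi|aPs]; first by exists Phi.
  exists (to_C0 cs); split => //; apply: eO => x; rewrite C0_fun_to_C0.
  rewrite opprD addrA subrr sub0r normrN normrM gtr0_norm// /s mulrAC ltr_pdivrMr//.
  rewrite ltr_pM2l//; apply: le_lt_trans (psiB x) _.
  by apply: le_lt_trans (ler_norm B) _; rewrite ltrDl.
have pos k : 0 < k.+1%:R^-1 :> R by rewrite invr_gt0.
have fullE : irregular_full T = \bigcap_k irregular_above T k.+1%:R^-1.
  apply/seteqP; split=> Phi.
    move=> [Phi0 Phih] k _; split; first exact: Phi0.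
    have -> : htop T (irregular_set T (C0_fun Phi)) = htop T [set: X] by exact: Phih.
    by have [a -> ah] := below_real (pos k) htop_gt0; exact: ah.
  move=> H; split; first by case: (H 0%N I).
  apply/eqP; rewrite eq_le; apply/andP; split; first exact: le_htop (@subsetT _ _).
  by apply: (le_of_below htop_gt0) => k; case: (H k I).
split=> [|eps]; last exact: od.
rewrite fullE; split.
  apply: (C0_baire X_compact) => k; [exact: (od _ (pos k)).1|exact: (od _ (pos k)).2].
exists (fun k => irregular_above T k.+1%:R^-1) => [k|]; last by [].
exact: (od _ (pos k)).1.
Qed.
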